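(* Let $P_0$ be a Noetherian ring, $P=P_0[y_1,\dots,y_n]$ the polynomial ring with the standard grading ($\deg y_i=1$, $P_0$ in degree $0$), and $P_+=(y_1,\dots,y_n)$. Let $M$ be a finitely generated graded $P$-module and let $\mathbb F:\ \cdots\to F_2\to F_1\to F_0\to 0$ be a graded free $P$-resolution of $M$ (by finitely generated free modules). Then there are graded isomorphisms $$H^{n-i}_{P_+}(M)\cong H_i\big(H^n_{P_+}(\mathbb F)\big)\qquad\text{for all } i .$$
   Context: $H^i_{P_+}$ denotes local cohomology with support in $P_+$, with its natural grading. $H^n_{P_+}(\mathbb F)$ is the complex $\cdots\to H^n_{P_+}(F_2)\to H^n_{P_+}(F_1)\to H^n_{P_+}(F_0)\to 0$ obtained by applying $H^n_{P_+}$ to $\mathbb F$, and $H_i$ denotes its $i$-th homology. Rings are commutative. *)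

(* Defs.v *)
From HB Require Import structures.
From mathcomp Require Import all_boot all_algebra.
From mathcomp Require Import boolp.
From mathcomp.multinomials Require Import mpoly.

Set Implicit Arguments.
Unset Strict Implicit.
Unset Printing Implicit Defensive.

Import GRing.Theory.
Local Open Scope ring_scope.

Definition ideal (R : comNzRingType) (I : R -> Prop) : Prop :=
  I 0 /\ forall a x y, I x -> I y -> I (a * x + y).

Definition ideal_span (R : comNzRingType) (k : nat) (g : 'I_k -> R) (x : R) :
    Prop :=
  exists c : 'I_k -> R, x = \sum_(j < k) c j * g j.

Definition noetherian (R : comNzRingType) : Prop :=
  forall I : R -> Prop, ideal I ->
    exists (k : nat) (g : 'I_k -> R), forall x, I x <-> ideal_span g x.

Section Graded.
Variables (R : comNzRingType) (n : nat).
Local Notation P := {mpoly R[n]}.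

(* A Z-graded P-module.  The decomposition M = (+)_d M_d is given by its
   projections: [hcomp d x] is the component of degree d of x, and M_d is
   [homogeneous d]. *)
Record gmod := GMod {
  gcar :> lmodType P;
  hcomp : int -> gcar -> gcar;
  hcompD : forall d x y, hcomp d (x + y) = hcomp d x + hcomp d y;
  hcomp_hcomp : forall d e x, hcomp d (hcomp e x) = if d == e then hcomp e x else 0;
  hcomp_sum : forall x, exists s : seq int, uniq s /\ x = \sum_(d <- s) hcomp d x;
  hcomp_scale : forall (k : nat) (p : P) (d : int) x,
    p \is k.-homog -> hcomp d x = x -> hcomp (k%:Z + d) (p *: x) = p *: x
}.

Definition homogeneous (M : gmod) (d : int) (x : M) : Prop := hcomp d x = x.

Record ghom (M N : gmod) := GHom {
  ghom_fun :> {linear M -> N};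
  ghom_hcomp : forall d x, ghom_fun (hcomp d x) = hcomp d (ghom_fun x)
}.

Definition gisom (M N : gmod) : Prop :=
  exists (f : ghom M N) (g : ghom N M), cancel f g /\ cancel g f.

Definition gfingen (M : gmod) : Prop :=
  exists (r : nat) (e : 'I_r -> M),
    forall x, exists c : 'I_r -> P, x = \sum_(j < r) c j *: e j.

(* Graded free of finite rank: F has a finite basis of homogeneous elements. *)
Definition gfree (F : gmod) : Prop :=
  exists (r : nat) (e : 'I_r -> F) (a : 'I_r -> int),
    (forall j, homogeneous (a j) (e j)) /\
    forall x, exists! c : {ffun 'I_r -> P}, x = \sum_(j < r) c j *: e j.

(* Injective object of the category of graded modules and degree-preserving
   maps. *)
Definition ginjective (E : gmod) : Prop :=
  forall (A B : gmod) (i : ghom A B) (f : ghom A E), injective i ->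
    exists g : ghom B E, forall x, g (i x) = f x.

Lemma hcomp0 (M : gmod) d : hcomp d (0 : M) = 0.
Proof. by apply: (addrI (hcomp d 0)); rewrite -hcompD !addr0. Qed.

Lemma hcomp_sumr (M : gmod) d (I : Type) (s : seq I) (f : I -> M) :
  hcomp d (\sum_(i <- s) f i) = \sum_(i <- s) hcomp d (f i).
Proof.
by apply: (big_morph (hcomp d)); [exact: hcompD | exact: hcomp0].
Qed.

Lemma hcompN (M : gmod) d (x : M) : hcomp d (- x) = - hcomp d x.
Proof. by apply: (addrI (hcomp d x)); rewrite -hcompD !subrr hcomp0. Qed.











Definition gzero_hcomp (d : int) (x : 'rV[P]_0) : 'rV[P]_0 := x.

Lemma gzero_eq (x y : 'rV[P]_0) : x = y.
Proof. by apply/matrixP => i []. Qed.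

Definition gzero : gmod := @GMod 'rV[P]_0 gzero_hcomp
  (fun _ _ _ => gzero_eq _ _) (fun _ _ _ => gzero_eq _ _)
  (fun x => ex_intro _ [::] (conj isT (gzero_eq _ _)))
  (fun _ _ _ _ _ _ => gzero_eq _ _).

Lemma gzero_hom_subproof (M N : gmod) d (x : M) :
  (\0 : {linear M -> N}) (hcomp d x) = hcomp d ((\0 : {linear M -> N}) x).
Proof. by rewrite /= hcomp0. Qed.

Definition gzero_hom (M N : gmod) : ghom M N :=
  GHom (@gzero_hom_subproof M N).

Record gsubmod (M : gmod) := GSubmod {
  gmem : M -> Prop;
  gmem0 : gmem 0;
  gmemL : forall (a : P) x y, gmem x -> gmem y -> gmem (a *: x + y);
  gmem_hcomp : forall d x, gmem x -> gmem (hcomp d x)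
}.

Section Sub.
Variables (M : gmod) (S : gsubmod M).

Definition gpred : {pred M} := fun x => `[< gmem S x >].

Lemma gpredP x : reflect (gmem S x) (x \in gpred).
Proof. exact: asboolP. Qed.

Lemma gpred_closed : submod_closed gpred.
Proof.
split; first exact/gpredP/gmem0.
by move=> a x y /gpredP Sx /gpredP Sy; apply/gpredP/gmemL.
Qed.

HB.instance Definition _ := GRing.isSubmodClosed.Build P M gpred gpred_closed.

Record gsub_car := GSubCar { gsub_val : M; _ : gsub_val \in gpred }.

HB.instance Definition _ := [isSub for gsub_val].
HB.instance Definition _ := [Choice of gsub_car by <:].
HB.instance Definition _ := [SubChoice_isSubLmodule of gsub_car by <:].

Lemma gsub_memP (x : gsub_car) : gmem S (val x).
Proof. by apply/gpredP; case: x. Qed.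

Definition gsub_in (x : M) (Sx : gmem S x) : gsub_car :=
  GSubCar (introT (gpredP x) Sx).

Definition gsub_hcomp (d : int) (x : gsub_car) : gsub_car :=
  gsub_in (gmem_hcomp d (gsub_memP x)).

Lemma gsub_hcompD d x y :
  gsub_hcomp d (x + y) = gsub_hcomp d x + gsub_hcomp d y.
Proof. by apply: val_inj; rewrite raddfD /= -hcompD. Qed.

Lemma gsub_hcomp_hcomp d e x :
  gsub_hcomp d (gsub_hcomp e x) = if d == e then gsub_hcomp e x else 0.
Proof.
apply: val_inj; rewrite /= hcomp_hcomp.
by case: eqP => // _; rewrite raddf0.
Qed.

Lemma gsub_hcomp_sum x :
  exists s : seq int, uniq s /\ x = \sum_(d <- s) gsub_hcomp d x.
Proof.
have [s [us xE]] := hcomp_sum (val x); exists s; split=> //.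
by apply: val_inj; rewrite raddf_sum.
Qed.

Lemma gsub_hcomp_scale (k : nat) (p : P) (d : int) x :
  p \is k.-homog -> gsub_hcomp d x = x -> gsub_hcomp (k%:Z + d) (p *: x) = p *: x.
Proof.
move=> ph /(congr1 val) /= xh; apply: val_inj.
exact: (hcomp_scale ph xh).
Qed.

Definition gsub : gmod :=
  GMod gsub_hcompD gsub_hcomp_hcomp gsub_hcomp_sum gsub_hcomp_scale.

End Sub.

Section SubHom.
Variables (M N : gmod) (S : gsubmod M) (T : gsubmod N) (f : ghom M N).
Hypothesis fST : forall x, gmem S x -> gmem T (f x).

Definition gsub_map (x : gsub S) : gsub T := gsub_in (fST (gsub_memP x)).

Lemma gsub_map_linear : linear gsub_map.
Proof. by move=> a x y; apply: val_inj; rewrite /= !linearP. Qed.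

HB.instance Definition _ :=
  GRing.isLinear.Build P (gsub S) (gsub T) _ gsub_map gsub_map_linear.

Lemma gsub_map_hcomp d x : gsub_map (hcomp d x) = hcomp d (gsub_map x).
Proof. by apply: val_inj; rewrite /= ghom_hcomp. Qed.

Definition gsub_hom : ghom (gsub S) (gsub T) :=
  @GHom (gsub S) (gsub T) gsub_map gsub_map_hcomp.

End SubHom.

Section Quot.
Local Open Scope quotient_scope.
Variables (M : gmod) (S : gsubmod M).

Definition gquot_car := @Quotient.quot M (gpred S).
HB.instance Definition _ := Choice.on gquot_car.
HB.instance Definition _ := GRing.Zmodule.on gquot_car.
HB.instance Definition _ := Quotient.on gquot_car.

Definition gpi (x : M) : gquot_car := \pi_gquot_car x.
Definition grepr (q : gquot_car) : M := repr q.

Lemma gpi_repr q : gpi (grepr q) = q.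
Proof. exact: reprK. Qed.

Lemma gpiP x y : gpi x = gpi y <-> gmem S (x - y).
Proof.
split; first by move=> /eqP; rewrite -Quotient.idealrBE => /gpredP.
by move=> Sxy; apply/eqP; rewrite -Quotient.idealrBE; apply/gpredP.
Qed.

Lemma gpiD x y : gpi (x + y) = gpi x + gpi y.
Proof. exact: (raddfD (\pi_(@Quotient.quot M (gpred S)))). Qed.

Definition gquot_scale (a : P) (q : gquot_car) : gquot_car := gpi (a *: grepr q).

Lemma gmemZ a x : gmem S x -> gmem S (a *: x).
Proof. by move=> Sx; rewrite -[_ *: _]addr0; apply: gmemL Sx (gmem0 S). Qed.

Lemma gpi_scale a x : gquot_scale a (gpi x) = gpi (a *: x).
Proof. by apply/gpiP; rewrite -scalerBr; apply/gmemZ/gpiP/gpi_repr. Qed.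

Lemma gquot_scalerA a b q :
  gquot_scale a (gquot_scale b q) = gquot_scale (a * b) q.
Proof. by rewrite -(gpi_repr q) !gpi_scale scalerA. Qed.

Lemma gquot_scale1r : left_id 1 gquot_scale.
Proof. by move=> q; rewrite -(gpi_repr q) gpi_scale scale1r. Qed.

Lemma gquot_scalerDr : right_distributive gquot_scale +%R.
Proof.
move=> a q r; rewrite -(gpi_repr q) -(gpi_repr r) -gpiD !gpi_scale.
by rewrite scalerDr gpiD.
Qed.

Lemma gquot_scalerDl q : {morph gquot_scale^~ q : a b / a + b}.
Proof. by move=> a b; rewrite /= -(gpi_repr q) !gpi_scale scalerDl gpiD. Qed.

HB.instance Definition _ := GRing.Zmodule_isLmodule.Build P gquot_car
  gquot_scalerA gquot_scale1r gquot_scalerDr gquot_scalerDl.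

Lemma gpi_linear : linear gpi.
Proof. by move=> a x y; rewrite gpiD -gpi_scale. Qed.

HB.instance Definition _ := GRing.isLinear.Build P M gquot_car _ gpi gpi_linear.

Definition gquot_hcomp (d : int) (q : gquot_car) : gquot_car :=
  gpi (hcomp d (grepr q)).

Lemma gquot_hcomp_pi d x : gquot_hcomp d (gpi x) = gpi (hcomp d x).
Proof.
apply/gpiP; rewrite -hcompN -hcompD.
exact/gmem_hcomp/gpiP/gpi_repr.
Qed.

Lemma gquot_hcompD d x y :
  gquot_hcomp d (x + y) = gquot_hcomp d x + gquot_hcomp d y.
Proof.
rewrite -(gpi_repr x) -(gpi_repr y) -gpiD !gquot_hcomp_pi.
by rewrite hcompD gpiD.
Qed.

Lemma gquot_hcomp_hcomp d e x :
  gquot_hcomp d (gquot_hcomp e x) = if d == e then gquot_hcomp e x else 0.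
Proof.
rewrite -(gpi_repr x) !gquot_hcomp_pi hcomp_hcomp.
by case: eqP => // _; rewrite raddf0.
Qed.

Lemma gquot_hcomp_sum x :
  exists s : seq int, uniq s /\ x = \sum_(d <- s) gquot_hcomp d x.
Proof.
have [s [us xE]] := hcomp_sum (grepr x); exists s; split=> //.
by rewrite -{1}(gpi_repr x) {1}xE raddf_sum.
Qed.

Lemma gquot_hcomp_scale (k : nat) (p : P) (d : int) x :
  p \is k.-homog -> gquot_hcomp d x = x ->
  gquot_hcomp (k%:Z + d) (p *: x) = p *: x.
Proof.
move=> ph xh.
have -> : p *: x = gpi (p *: hcomp d (grepr x)) by rewrite linearZ /= -{1}xh.
by rewrite gquot_hcomp_pi hcomp_scale // hcomp_hcomp eqxx.
Qed.

Definition gquot : gmod :=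
  GMod gquot_hcompD gquot_hcomp_hcomp gquot_hcomp_sum gquot_hcomp_scale.

End Quot.

Section QuotHom.
Variables (M N : gmod) (S : gsubmod M) (T : gsubmod N) (f : ghom M N).
Hypothesis fST : forall x, gmem S x -> gmem T (f x).

Definition gquot_map (q : gquot S) : gquot T := gpi T (f (grepr q)).

Lemma gquot_map_pi x : gquot_map (gpi S x) = gpi T (f x).
Proof. by apply/gpiP; rewrite -linearB; apply/fST/gpiP/gpi_repr. Qed.

Lemma gquot_map_linear : linear gquot_map.
Proof.
move=> a x y; rewrite -(gpi_repr x) -(gpi_repr y) -linearP !gquot_map_pi.
by rewrite !linearP.
Qed.

HB.instance Definition _ :=
  GRing.isLinear.Build P (gquot S) (gquot T) _ gquot_map gquot_map_linear.

Lemma gquot_map_hcomp d x : gquot_map (hcomp d x) = hcomp d (gquot_map x).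
Proof.
have hE L (U : gsubmod L) y : hcomp d (gpi U y : gquot U) = gpi U (hcomp d y).
  exact: gquot_hcomp_pi.
by rewrite -(gpi_repr x) hE !gquot_map_pi ghom_hcomp hE.
Qed.

Definition gquot_hom : ghom (gquot S) (gquot T) :=
  @GHom (gquot S) (gquot T) gquot_map gquot_map_hcomp.

End QuotHom.

Section Homology.
Variables (A B C : gmod) (f : ghom A B) (g : ghom B C).

Lemma gker_linear (a : P) x y : g x = 0 -> g y = 0 -> g (a *: x + y) = 0.
Proof. by move=> gx gy; rewrite linearP gx gy scaler0 addr0. Qed.

Lemma gker_hcomp d x : g x = 0 -> g (hcomp d x) = 0.
Proof. by move=> gx; rewrite ghom_hcomp gx hcomp0. Qed.

Definition gker : gsubmod B :=
  @GSubmod B (fun x => g x = 0) (linear0 g) gker_linear gker_hcomp.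

Definition gbound_mem (z : gsub gker) : Prop := exists x : A, f x = val z.

Lemma gbound0 : gbound_mem 0.
Proof. by exists 0; rewrite !linear0. Qed.

Lemma gbound_linear (a : P) x y :
  gbound_mem x -> gbound_mem y -> gbound_mem (a *: x + y).
Proof. by case=> u fu [v fv]; exists (a *: u + v); rewrite !linearP fu fv. Qed.

Lemma gbound_hcomp d x : gbound_mem x -> gbound_mem (hcomp d x).
Proof. by case=> u fu; exists (hcomp d u); rewrite ghom_hcomp fu. Qed.

Definition gbound : gsubmod (gsub gker) :=
  GSubmod gbound0 gbound_linear gbound_hcomp.

(* ker g / im f, for composable f and g (when g \o f = 0). *)
Definition homology : gmod := gquot gbound.

End Homology.

Section HomologyMap.
Variables (A B C A' B' C' : gmod).
Variables (f : ghom A B) (g : ghom B C) (f' : ghom A' B') (g' : ghom B' C').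
Variables (a : ghom A A') (b : ghom B B') (c : ghom C C').
Hypotheses (ab : forall x, b (f x) = f' (a x)) (bc : forall x, c (g x) = g' (b x)).

Lemma gker_map x : gmem (gker g) x -> gmem (gker g') (b x).
Proof. by move=> /= gx; rewrite -bc gx linear0. Qed.

Lemma gbound_map z :
  gmem (gbound f g) z -> gmem (gbound f' g') (gsub_hom gker_map z).
Proof. by case=> x fx; exists (a x); rewrite -ab fx. Qed.

Definition homology_map : ghom (homology f g) (homology f' g') :=
  gquot_hom gbound_map.

End HomologyMap.

(* The complex is extended by 0 on the left; likewise on the right in
   [chain_homology]. *)
Definition cohomology (C : nat -> gmod) (d : forall j, ghom (C j) (C j.+1))
    (j : nat) : gmod :=
  match j with
  | 0 => homology (gzero_hom gzero (C 0)) (d 0)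
  | k.+1 => homology (d k) (d k.+1)
  end.

Section CohomologyMap.
Variables (C D : nat -> gmod).
Variables (dC : forall j, ghom (C j) (C j.+1)) (dD : forall j, ghom (D j) (D j.+1)).
Variable phi : forall j, ghom (C j) (D j).
Hypothesis phi_d : forall j x, phi j.+1 (dC j x) = dD j (phi j x).

Lemma cohomology_map0 (x : gzero) :
  phi 0 (gzero_hom gzero (C 0) x) = gzero_hom gzero (D 0) (gzero_hom gzero gzero x).
Proof. exact: linear0. Qed.

Definition cohomology_map (j : nat) : ghom (cohomology dC j) (cohomology dD j) :=
  match j with
  | 0 => homology_map cohomology_map0 (phi_d (j := 0))
  | k.+1 => homology_map (phi_d (j := k)) (phi_d (j := k.+1))
  end.

End CohomologyMap.

Definition chain_homology (C : nat -> gmod) (d : forall i, ghom (C i.+1) (C i))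
    (i : nat) : gmod :=
  match i with
  | 0 => homology (d 0) (gzero_hom (C 0) gzero)
  | k.+1 => homology (d k.+1) (d k)
  end.

Definition Pplus : P -> Prop := ideal_span (fun i : 'I_n => 'X_i).

(* x is killed by the power P_+^k, i.e. by every product of k elements of
   P_+. *)
Definition killed (M : gmod) (k : nat) (x : M) : Prop :=
  forall a : 'I_k -> P, (forall i, Pplus (a i)) -> (\prod_(i < k) a i) *: x = 0.

Lemma hcomp_scaleE (M : gmod) (k : nat) (p : P) (d : int) (x : M) :
  p \is k.-homog -> hcomp (k%:Z + d) (p *: x) = p *: hcomp d x.
Proof.
move=> ph; have [s [us xE]] := hcomp_sum x.
have hx e : hcomp (k%:Z + d) (p *: hcomp e x) = if d == e then p *: hcomp e x else 0.
  have /(hcomp_scale ph) <- : hcomp e (hcomp e x) = hcomp e x.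
    by rewrite hcomp_hcomp eqxx.
  by rewrite hcomp_hcomp (inj_eq (addrI _)).
rewrite {1}xE scaler_sumr hcomp_sumr (eq_bigr _ (fun e _ => hx e)).
rewrite {2}xE hcomp_sumr scaler_sumr; apply: eq_bigr => e _.
by rewrite hcomp_hcomp; case: eqP => // _; rewrite scaler0.
Qed.

Lemma Pplus_prod (k : nat) (a : 'I_k -> P) : (forall i, Pplus (a i)) ->
  exists c : {ffun 'I_k -> 'I_n} -> P,
    \prod_(i < k) a i = \sum_f c f * \prod_(i < k) 'X_(f i).
Proof.
move=> /choice [c aE].
exists (fun f => \prod_(i < k) c i (f i)).
rewrite (eq_bigr _ (fun i _ => aE i)) bigA_distr_bigA.
by apply: eq_bigr => f _; rewrite big_split.
Qed.

Lemma Xprod_homog (k : nat) (f : 'I_k -> 'I_n) :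
  (\prod_(i < k) 'X_(f i) : P) \is k.-homog.
Proof.
elim: k f => [|k IHk] f; first by rewrite big_ord0 dhomog1.
have X1 : ('X_(f ord0) : P) \is 1.-homog by rewrite dhomogX /= mdeg1.
by rewrite big_ord_recl; apply: (dhomogM X1 (IHk (fun i => f (lift ord0 i)))).
Qed.

Lemma Pplus_X i : Pplus 'X_i.
Proof.
exists (fun j => (j == i)%:R); rewrite (bigD1 i) //= eqxx mul1r.
by rewrite big1 ?addr0 // => j /negPf ->; rewrite mul0r.
Qed.

Lemma killedW (M : gmod) (k l : nat) (x : M) :
  killed k x -> killed (k + l) x /\ killed (l + k) x.
Proof.
move=> kx; split=> a aP; rewrite big_split_ord /=.
  by rewrite mulrC -scalerA kx ?scaler0.
by rewrite -scalerA kx ?scaler0.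
Qed.

Definition torsion_mem (M : gmod) (x : M) : Prop := exists k, killed k x.

Lemma torsion0 (M : gmod) : torsion_mem (0 : M).
Proof. by exists 0 => a _; rewrite scaler0. Qed.

Lemma torsion_linear (M : gmod) (a : P) (x y : M) :
  torsion_mem x -> torsion_mem y -> torsion_mem (a *: x + y).
Proof.
move=> [k kx] [l ly]; exists (k + l)%N => b bP.
have [kx' _] := killedW l kx; have [_ ly'] := killedW k ly.
by rewrite scalerDr scalerA mulrC -scalerA kx' // ly' // scaler0 addr0.
Qed.

Lemma torsion_hcomp (M : gmod) d (x : M) : torsion_mem x -> torsion_mem (hcomp d x).
Proof.
case=> k kx; exists k => a /Pplus_prod [c ->]; rewrite scaler_suml big1 // => f _.
rewrite -scalerA -(hcomp_scaleE _ _ (Xprod_homog f)) kx; last first.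
  by move=> i; apply: Pplus_X.
by rewrite hcomp0 scaler0.
Qed.

Definition torsion (M : gmod) : gsubmod M :=
  @GSubmod M (@torsion_mem M) (torsion0 M) (@torsion_linear M) (@torsion_hcomp M).

Lemma torsion_map (M N : gmod) (f : ghom M N) x :
  gmem (torsion M) x -> gmem (torsion N) (f x).
Proof.
by case=> k kx; exists k => a aP; rewrite -linearZ kx ?linear0.
Qed.

Definition Gamma (M : gmod) : gmod := gsub (torsion M).

Definition Gamma_hom (M N : gmod) (f : ghom M N) : ghom (Gamma M) (Gamma N) :=
  gsub_hom (torsion_map f).

Record ginjres (M : gmod) := GInjRes {
  ir_obj :> nat -> gmod;
  ir_d : forall j, ghom (ir_obj j) (ir_obj j.+1);
  ir_eps : ghom M (ir_obj 0);
  ir_injective : forall j, ginjective (ir_obj j);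
  ir_eps_inj : injective ir_eps;
  ir_exact0 : forall x, ir_d 0 x = 0 <-> exists m, ir_eps m = x;
  ir_exact : forall j x, ir_d j.+1 x = 0 <-> exists y, ir_d j y = x
}.

Record ginjres_lift (M N : gmod) (I : ginjres M) (J : ginjres N) (f : ghom M N) :=
  GInjResLift {
    irl_fun :> forall j, ghom (I j) (J j);
    irl_eps : forall m, irl_fun 0 (ir_eps I m) = ir_eps J (f m);
    irl_d : forall j x, irl_fun j.+1 (ir_d I j x) = ir_d J j (irl_fun j x)
  }.

(* H^j_{P_+}(M) and H^j_{P_+}(f): the graded right derived functors of
   [Gamma], computed from injective resolutions I, J of M, N in the category of
   graded modules and a lift of f : M -> N. *)
Definition local_cohomology (M : gmod) (I : ginjres M) (j : nat) : gmod :=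
  cohomology (C := fun j => Gamma (I j)) (fun j => Gamma_hom (ir_d I j)) j.

Lemma Gamma_lift (M N : gmod) (I : ginjres M) (J : ginjres N) (f : ghom M N)
    (phi : ginjres_lift I J f) j (x : Gamma (I j)) :
  Gamma_hom (phi j.+1) (Gamma_hom (ir_d I j) x) =
  Gamma_hom (ir_d J j) (Gamma_hom (phi j) x).
Proof. by apply: val_inj; apply: irl_d. Qed.

Definition local_cohomology_map (M N : gmod) (I : ginjres M) (J : ginjres N)
    (f : ghom M N) (phi : ginjres_lift I J f) (j : nat) :
    ghom (local_cohomology I j) (local_cohomology J j) :=
  cohomology_map (Gamma_lift phi) j.

Record gfreeres (M : gmod) := GFreeRes {
  fr_obj :> nat -> gmod;
  fr_d : forall i, ghom (fr_obj i.+1) (fr_obj i);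
  fr_aug : ghom (fr_obj 0) M;
  fr_free : forall i, gfree (fr_obj i);
  fr_aug_surj : forall m, exists x, fr_aug x = m;
  fr_exact0 : forall x, fr_aug x = 0 <-> exists y, fr_d 0 y = x;
  fr_exact : forall i x, fr_d i x = 0 <-> exists y, fr_d i.+1 y = x
}.

Definition extend0 (H : nat -> gmod) (i : int) : gmod :=
  match i with Posz k => H k | Negz _ => gzero end.

End Graded.

(* Main.v *)
From HB Require Import structures.
Require Import Defs.
From mathcomp Require Import all_boot all_algebra.
From mathcomp Require Import boolp.
From mathcomp.multinomials Require Import mpoly.

Set Implicit Arguments.
Unset Strict Implicit.
Unset Printing Implicit Defensive.

Import GRing.Theory.
Local Open Scope ring_scope.

(** Write Gamma for torsion with respect to the irrelevant ideal, and H^j for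
    its derived functors.  The theorem is dimension shifting along the
    syzygies K_0 = M, K_1, K_2, ... of the free resolution.  Two facts are
    needed: H^j vanishes on every module for j > n ([tors_acyclic_high]), and it
    vanishes on each F_k for j < n as well ([tors_acyclic_low]).  The sequences
    0 -> K_(k+1) -> F_k -> K_k -> 0 then give H^j(K_k) = H^(j+1)(K_(k+1)) for
    j + 1 < n ([shift_gisom]), and they make H^n right exact.  Therefore H^n(K_k)
    is the cokernel of H^n(F_(k+1)) -> H^n(F_k), and
    H^(n-1)(K_k) = ker (H^n(K_(k+1)) -> H^n(F_k)) is the homology of H^n(F) in
    degree k + 1 ([gisom_homology0], [gisom_homologyS]).

    Both vanishing statements are proved on injective resolutions.  Fix t and
    consider, for k <= n, the elements annihilated by X_i^t for all i < k; the
    union over t of those with k = n is Gamma ([torsionP]).  Since the powers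
    X_i^t form a regular sequence on P, multiplication by the next power is
    surjective on the elements of an injective module annihilated by the first k
    powers ([injective_divisible]).  So each further power gives a short
    exact sequence of complexes.  Induction on k shows that cohomology vanishes
    above degree k, and, for a resolution of a module F on which the powers are
    a regular sequence, also below degree k, where the cohomology in degree k is
    F/(X_0^t, ..., X_(k-1)^t)F ([connected_bound]).

    Injective resolutions of the syzygies are not given, but they can be made
    from the given ones: if J resolves K_k and psi lifts F_k -> K_k to the
    resolutions, then the cone of psi resolves K_(k+1) ([cone]).  The lift to
    the next cone consists of phi and of a null-homotopy of psi \o phi
    ([next_psi]).  The long exact sequence of a cone has psi as its connecting
    map, which relates the maps induced by phi to the syzygies. *)

(** * Graded maps, products and isomorphisms *)

Section GradedModules.
Variables (R : comNzRingType) (n : nat).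
Local Notation P := {mpoly R[n]}.
Local Notation gmod := (gmod R n).

Section Homs.
Variables (M N : gmod).

Definition mk_ghom (f : M -> N) (lf : linear f)
    (hf : forall d x, f (hcomp d x) = hcomp d (f x)) : ghom M N :=
  let fl : {linear M -> N} := HB.pack f (GRing.isLinear.Build _ _ _ _ f lf) in
  @GHom _ _ M N fl hf.

Lemma ghom_of (f : M -> N) : linear f ->
  (forall d x, f (hcomp d x) = hcomp d (f x)) -> exists g : ghom M N, g =1 f.
Proof. by move=> lf hf; exists (mk_ghom lf hf). Qed.

(** An additive relation that is graded, total, onto, and has trivial kernel
    on both sides is the graph of an isomorphism.  Every isomorphism below is
    produced this way, so that connecting maps never need to be chosen. *)
Lemma gisom_rel (rel : M -> N -> Prop) :
  (forall (a : P) x y x' y', rel x y -> rel x' y' -> rel (a *: x + x') (a *: y + y')) ->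
  (forall d x y, rel x y -> rel (hcomp d x) (hcomp d y)) ->
  (forall x, exists y, rel x y) -> (forall y, exists x, rel x y) ->
  (forall y, rel 0 y -> y = 0) -> (forall x, rel x 0 -> x = 0) ->
  gisom M N.
Proof.
move=> relL relH /choice[f fP] /choice[g gP] rel0l rel0r.
have relB x y x' y' : rel x y -> rel x' y' -> rel (x - x') (y - y').
  by move=> h h'; move: (relL (-1) _ _ _ _ h' h); rewrite !scaleN1r ![- _ + _]addrC.
have funr x y y' : rel x y -> rel x y' -> y = y'.
  by move=> h h'; apply/subr0_eq/rel0l; rewrite -(subrr x); apply: relB.
have funl x x' y : rel x y -> rel x' y -> x = x'.
  by move=> h h'; apply/subr0_eq/rel0r; rewrite -(subrr y); apply: relB.
have lf : linear f by move=> a x y; apply: funr (fP _) (relL _ _ _ _ _ _ _).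
have lg : linear g by move=> a x y; apply: funl (gP _) (relL _ _ _ _ _ _ _).
pose fl : {linear M -> N} := HB.pack f (GRing.isLinear.Build _ _ _ _ f lf).
pose gl : {linear N -> M} := HB.pack g (GRing.isLinear.Build _ _ _ _ g lg).
have hf d x : fl (hcomp d x) = hcomp d (fl x) by apply: funr (fP _) (relH _ _ _ _).
have hg d x : gl (hcomp d x) = hcomp d (gl x) by apply: funl (gP _) (relH _ _ _ _).
exists (GHom hf), (GHom hg); split=> x /=.
  exact: funl (gP _) (fP _).
exact: funr (fP _) (gP _).
Qed.

Lemma gisom_sym : gisom M N -> gisom N M.
Proof. by case=> f [g [fK gK]]; exists g, f. Qed.

Lemma gisom_eq0 : gisom M N -> (forall y : N, y = 0) -> forall x : M, x = 0.
Proof. by case=> f [g [fK gK]] N0 x; rewrite -(fK x) (N0 (f x)) linear0. Qed.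

Lemma gisom_zero : (forall x : M, x = 0) -> (forall y : N, y = 0) -> gisom M N.
Proof.
move=> M0 N0; exists (gzero_hom M N), (gzero_hom N M).
by split=> x; rewrite [LHS](M0, N0) [RHS](M0, N0).
Qed.

End Homs.

Lemma gisom_refl (M : gmod) : gisom M M.
Proof.
pose h : ghom M M := @GHom _ _ M M idfun (fun _ _ => erefl).
by exists h, h.
Qed.

Lemma gisom_trans (M N L : gmod) : gisom M N -> gisom N L -> gisom M L.
Proof.
case=> f [g [fK gK]] [f' [g' [fK' gK']]].
have hf d x : (f' \o f) (hcomp d x) = hcomp d ((f' \o f) x) by rewrite /= !ghom_hcomp.
have hg d x : (g \o g') (hcomp d x) = hcomp d ((g \o g') x) by rewrite /= !ghom_hcomp.
by exists (GHom hf), (GHom hg); split=> x /=; rewrite ?fK' ?fK ?gK ?gK'.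
Qed.

Section Product.
Variables (M N : gmod).

Definition gprod_hcomp d (x : (M * N)%type) : (M * N)%type :=
  (hcomp d x.1, hcomp d x.2).

Lemma gprod_hcompD d x y : gprod_hcomp d (x + y) = gprod_hcomp d x + gprod_hcomp d y.
Proof. by rewrite /gprod_hcomp !hcompD. Qed.

Lemma gprod_hcomp_hcomp d e x :
  gprod_hcomp d (gprod_hcomp e x) = if d == e then gprod_hcomp e x else 0.
Proof. by rewrite /gprod_hcomp !hcomp_hcomp /=; case: eqP. Qed.

Lemma hcomp_notin (L : gmod) (s : seq int) (x : L) d :
  x = \sum_(e <- s) hcomp e x -> d \notin s -> hcomp d x = 0.
Proof.
move=> xE ds; rewrite xE hcomp_sumr big_seq big1 // => e es.
by rewrite hcomp_hcomp; case: eqP => // de; rewrite de es in ds.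
Qed.

Lemma hcomp_sum_sub (L : gmod) (s s' : seq int) (x : L) :
  uniq s -> uniq s' -> {subset s <= s'} -> x = \sum_(e <- s) hcomp e x ->
  x = \sum_(e <- s') hcomp e x.
Proof.
move=> us us' ss' xE; rewrite {1}xE.
rewrite [RHS](bigID (fun e => e \in s)) /= [X in _ + X]big1 ?addr0.
  rewrite -[RHS]big_filter; apply: perm_big; apply: uniq_perm => //; first exact: filter_uniq.
  by move=> e; rewrite mem_filter; case: (boolP (e \in s)) => // /ss' ->.
by move=> e; apply: hcomp_notin xE.
Qed.

Lemma gprod_hcomp_sum x : exists s, uniq s /\ x = \sum_(d <- s) gprod_hcomp d x.
Proof.
case: x => x y; have [s [us xE]] := hcomp_sum x; have [t [ut yE]] := hcomp_sum y.
exists (undup (s ++ t)); split; first exact: undup_uniq.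
have uu := undup_uniq (s ++ t).
rewrite [LHS]surjective_pairing [RHS]surjective_pairing; congr pair.
  rewrite (raddf_sum (@fst M N)) /=; apply: hcomp_sum_sub us uu _ xE.
  by move=> e es; rewrite mem_undup mem_cat es.
rewrite (raddf_sum (@snd M N)) /=; apply: hcomp_sum_sub ut uu _ yE.
by move=> e es; rewrite mem_undup mem_cat es orbT.
Qed.

Lemma gprod_hcomp_scale (k : nat) (p : P) (d : int) x : p \is k.-homog ->
  gprod_hcomp d x = x -> gprod_hcomp (k%:Z + d) (p *: x) = p *: x.
Proof.
by case: x => x y ph [hx hy]; congr pair; rewrite /= hcomp_scaleE ?hx ?hy.
Qed.

Definition gprod : gmod :=
  GMod gprod_hcompD gprod_hcomp_hcomp gprod_hcomp_sum gprod_hcomp_scale.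

End Product.

End GradedModules.

(** * Graded injective modules *)

Section Injectives.
Variables (R : comNzRingType) (n : nat).
Local Notation P := {mpoly R[n]}.
Local Notation gmod := (gmod R n).

(** Pushing E out along the relation S keeps E embedded, because S meets E in
    0; injectivity retracts the pushout onto E, and the restriction of the
    retraction to B is g.  Both extension along a map and divisibility of
    elements are obtained from this by a choice of S, so that quotients of P
    need not be formed. *)
Lemma injective_rel (E B : gmod) (S : gsubmod (gprod E B)) : ginjective E ->
  (forall e, gmem S (e, 0) -> e = 0) ->
  exists g : ghom B E, forall e b, gmem S (e, b) -> g b = - e.
Proof.
move=> Einj S0.
have [i iE] : exists i : ghom E (gquot S), i =1 (fun e => gpi S (e, 0) : gquot S).
  apply: ghom_of => [a x y|d x]; last first.
    by rewrite [RHS]gquot_hcomp_pi; congr (gpi S (_, _)); rewrite /= hcomp0.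
  by rewrite -linearP; congr (gpi S (_, _)); rewrite /= scaler0 addr0.
have iinj : injective i.
  move=> x y; rewrite !iE => /gpiP Sxy; apply/subr0_eq/S0.
  by move: Sxy; congr (gmem S (_, _)); rewrite /= subrr.
pose idE : ghom E E := @GHom _ _ E E idfun (fun _ _ => erefl).
have [g0 g0i] := Einj _ _ i idE iinj.
have [g gE] : exists g : ghom B E, g =1 (fun b => g0 (gpi S (0, b) : gquot S)).
  apply: ghom_of => [a x y|d x]; last first.
    rewrite -[RHS]ghom_hcomp [hcomp d (_ : gquot S)]gquot_hcomp_pi.
    by congr (g0 (gpi S (_, _))); rewrite /= hcomp0.
  rewrite -linearP -linearP; congr (g0 (gpi S (_, _))).
  by rewrite /= scaler0 addr0.
exists g => e b Seb; rewrite gE; apply/eqP; rewrite -addr_eq0; apply/eqP.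
rewrite -[X in _ + X]/(idE e) -g0i iE -linearD -[RHS](linear0 g0); congr (g0 _).
rewrite -linearD -[RHS](linear0 (gpi S)); apply/gpiP; rewrite subr0.
by move: Seb; congr (gmem S (_, _)); rewrite /= ?add0r ?addr0.
Qed.

Lemma injective_extend (E A B : gmod) (h : ghom A E) (d : ghom A B) :
  ginjective E -> (forall x, d x = 0 -> h x = 0) ->
  exists g : ghom B E, forall x, g (d x) = h x.
Proof.
move=> Einj dh.
pose S (z : gprod E B) := exists x, z = (h x, - d x).
have S0 : S 0 by exists 0; rewrite (linear0 h) (linear0 d) oppr0.
have SL (a : P) x y : S x -> S y -> S (a *: x + y).
  move=> [u ->] [v ->]; exists (a *: u + v); rewrite !linearP.
  by congr pair; rewrite /= opprD scalerN.
have SH e x : S x -> S (hcomp e x).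
  by move=> [u ->]; exists (hcomp e u); rewrite !ghom_hcomp -hcompN.
have Sker e : S (e, 0) -> e = 0.
  by move=> [x [-> /esym/eqP]]; rewrite oppr_eq0 => /eqP; exact: dh.
have [g gE] := @injective_rel E B (GSubmod S0 SL SH) Einj Sker.
exists g => x; apply: oppr_inj; rewrite -linearN; apply: gE.
by exists x.
Qed.

Section Shift.
Variable s : int.

Definition shift_hcomp (d : int) (p : P^o) : P^o :=
  if d - s is Posz k then pihomog mdeg k p else 0.

Lemma shift_hcompD d x y : shift_hcomp d (x + y) = shift_hcomp d x + shift_hcomp d y.
Proof. by rewrite /shift_hcomp; case: (d - s) => k; rewrite ?pihomogD ?addr0. Qed.

Lemma shift_hcompE (k : nat) p : shift_hcomp (s + k%:Z) p = pihomog mdeg k p.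
Proof. by rewrite /shift_hcomp addrC addKr. Qed.

Lemma shift_hcomp_hcomp d e x :
  shift_hcomp d (shift_hcomp e x) = if d == e then shift_hcomp e x else 0.
Proof.
rewrite -(inj_eq (addIr (- s))) /shift_hcomp.
case: (d - s) (e - s) => k [l|l] //; rewrite ?pihomog0 ?if_same //.
have [[<-]|kl] := eqVneq; first by rewrite pihomog_id.
by rewrite (pihomog_ne0 _ (pihomogP _ l x)) // eq_sym.
Qed.

Lemma shift_hcomp_sum x : exists l, uniq l /\ x = \sum_(d <- l) shift_hcomp d x.
Proof.
exists [seq s + k%:Z | k <- iota 0 (mmeasure mdeg x)]; split.
  by rewrite map_inj_uniq ?iota_uniq // => k l /addrI [].
rewrite big_map {1}(pihomog_partitionE (leqnn (mmeasure mdeg x))).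
rewrite -(big_mkord xpredT (fun k => pihomog mdeg k x)) /index_iota subn0.
by apply: eq_bigr => k _; rewrite shift_hcompE.
Qed.

Lemma shift_hcomp_scale (k : nat) (p : P) (d : int) x : p \is k.-homog ->
  shift_hcomp d x = x -> shift_hcomp (k%:Z + d) (p *: x) = p *: x.
Proof.
rewrite /shift_hcomp -addrA; case: (d - s) => l ph; last first.
  by move=> <-; rewrite scaler0; case: (_ + _) => // ?; rewrite pihomog0.
by move=> xl; apply: pihomog_dE; apply: dhomogM => //; rewrite -xl pihomogP.
Qed.

(** The twist P(-s): its generator 1 has degree s. *)
Definition gshift : gmod :=
  @GMod R n P^o shift_hcomp shift_hcompD shift_hcomp_hcomp shift_hcomp_sum
    shift_hcomp_scale.

End Shift.
End Injectives.

(** * Powers of the variables as a regular sequence *)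

Section RegularSequence.
Variables (R : comNzRingType) (n : nat).
Local Notation P := {mpoly R[n]}.
Local Notation gmod := (gmod R n).

Definition annihilated (u : nat -> P) (k : nat) (M : lmodType P) (x : M) : Prop :=
  forall l, (l < k)%N -> u l *: x = 0.

Lemma annihilatedS u k (M : lmodType P) (x : M) :
  annihilated u k.+1 x <-> annihilated u k x /\ u k *: x = 0.
Proof.
split=> [ux|[ux uk] l]; first by split=> [l lk|]; apply: ux; rewrite // ltnS ltnW.
by rewrite ltnS leq_eqVlt => /predU1P[->|/ux].
Qed.

Lemma annihilatedL u k (M : lmodType P) (a : P) (x y : M) :
  annihilated u k x -> annihilated u k y -> annihilated u k (a *: x + y).
Proof.
move=> ux uy l lk.
by rewrite scalerDr scalerA mulrC -scalerA ux // uy // scaler0 addr0.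
Qed.

Lemma annihilatedB u k (M : lmodType P) (x y : M) :
  annihilated u k x -> annihilated u k y -> annihilated u k (x - y).
Proof. by move=> ux uy; rewrite addrC -scaleN1r; apply: annihilatedL. Qed.

Lemma annihilatedZ u k (M : lmodType P) (a : P) (x : M) :
  annihilated u k x -> annihilated u k (a *: x).
Proof. by move=> ux l lk; rewrite scalerA mulrC -scalerA ux ?scaler0. Qed.

Lemma annihilated_map u k (M N : lmodType P) (f : {linear M -> N}) (x : M) :
  annihilated u k x -> annihilated u k (f x).
Proof. by move=> ux l lk; rewrite -linearZ ux ?linear0. Qed.

Lemma annihilated0 u k (M : lmodType P) : annihilated u k (0 : M).
Proof. by move=> l _; rewrite scaler0. Qed.

Variable t : nat.

Definition varpow (l : nat) : P := if insub l is Some i then 'X_(i : 'I_n) ^+ t else 0.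

Lemma varpowE (i : 'I_n) : varpow i = 'X_[U_(i) *+ t].
Proof. by rewrite /varpow valK mpolyXn. Qed.

Lemma varpow_homog (i : 'I_n) : varpow i \is t.-homog.
Proof. by rewrite varpowE dhomogX /= mdegMn mdeg1 mul1n. Qed.

(** The ideal generated by the t-th powers of the first k variables: each
    monomial that occurs has exponent at least t in one of them. *)
Definition powideal (k : nat) (p : P) : Prop :=
  forall m : 'X_{1..n}, (forall i : 'I_n, (i < k)%N -> (m i < t)%N) -> p@_m = 0.

Lemma powideal0 k : powideal k 0.
Proof. by move=> m _; rewrite mcoeff0. Qed.

Lemma powidealD k p q : powideal k p -> powideal k q -> powideal k (p + q).
Proof. by move=> pk qk m mk; rewrite mcoeffD pk // qk // addr0. Qed.

Lemma powidealM k a p : powideal k p -> powideal k (a * p).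
Proof.
move=> pk m mk; rewrite mcoeffM big1 // => -[/= m1 m2] /eqP mE.
rewrite [X in _ * X]pk ?mulr0 // => i /mk; apply: leq_ltn_trans.
by rewrite [X in (_ <= (X : 'X_{1..n}) i)%N]mE mnmDE leq_addl.
Qed.

Lemma powidealL k (a p q : P) : powideal k p -> powideal k q -> powideal k (a * p + q).
Proof. by move=> pk qk; apply: powidealD => //; apply: powidealM. Qed.

Lemma mcoeff_filter (p : P) (Q : pred 'X_{1..n}) m :
  (\sum_(m <- msupp p | Q m) p@_m *: 'X_[m])@_m = if Q m then p@_m else 0.
Proof.
rewrite raddf_sum /= big_mkcond /=.
have -> : p@_m = \sum_(m' <- msupp p) p@_m' * ('X_[m'] : P)@_m.
  by rewrite {1}[p]mpolyE raddf_sum /=; apply: eq_bigr => m' _; rewrite mcoeffZ.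
have [Qm|Qm] := boolP (Q m).
  apply: eq_bigr => m' _; rewrite mcoeffZ mcoeffX; case: eqP => [->|_]; first by rewrite Qm.
  by rewrite mulr0 if_same.
apply: big1 => m' _; case: ifP => // Qm'; rewrite mcoeffZ mcoeffX.
by case: eqP Qm Qm' => [->|_]; rewrite ?mulr0 // => /negPf ->.
Qed.

Lemma powideal_pihomog k d p : powideal k p -> powideal k (pihomog mdeg d p).
Proof. by move=> pk m mk; rewrite mcoeff_filter pk // if_same. Qed.

Lemma powideal_varpow k (i : 'I_n) : (i < k)%N -> powideal k (varpow i).
Proof.
move=> ik m mk; rewrite varpowE mcoeffX; case: eqP => // mE.
by move: (mk i ik); rewrite -mE mulmnE mnm1E eqxx mul1n ltnn.
Qed.

Lemma powidealS k p : powideal k p -> powideal k.+1 p.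
Proof. by move=> pk m mk; apply: pk => i ik; apply/mk/ltnW. Qed.

(** The powers of the variables form a regular sequence: multiplication by the
    i-th one shifts exponents of the variable i only, while membership in the
    ideal of the earlier powers is decided by the other exponents. *)
Lemma powideal_regular (i : 'I_n) p : powideal i (varpow i * p) -> powideal i p.
Proof.
move=> pk m mk; rewrite -(mcoeffMX p (U_(i) *+ t)%MM) mulrC -varpowE; apply: pk => l li.
rewrite mnmDE mulmnE mnm1E; case: eqP => [il|_]; last by rewrite mul0n add0n mk.
by rewrite il ltnn in li.
Qed.

(** The ideals [powideal] are those generated by the successive powers: q
    collects the monomials divisible by the i-th power. *)
Lemma powideal_succ (i : 'I_n) p : powideal i.+1 p ->
  exists q, powideal i (p - varpow i * q).
Proof.
move=> pk; exists (\sum_(m <- msupp p | (t <= m i)%N) p@_m *: 'X_[m - U_(i) *+ t]).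
have -> : varpow i * (\sum_(m <- msupp p | (t <= m i)%N) p@_m *: 'X_[m - U_(i) *+ t])
    = \sum_(m <- msupp p | (t <= m i)%N) p@_m *: 'X_[m].
  rewrite mulr_sumr; apply: eq_bigr => m tm; rewrite varpowE -scalerAr -mpolyXD addmC submK //.
  apply/mnm_lepP => l; rewrite mulmnE mnm1E; case: eqP => [<-|_]; last by rewrite mul0n.
  by rewrite mul1n.
move=> m mk; rewrite mcoeffB mcoeff_filter; case: leqP => tm; first by rewrite subrr.
rewrite subr0; apply: pk => l; rewrite ltnS leq_eqVlt => /predU1P[|/mk //].
by move=> /val_inj ->.
Qed.

Lemma powideal_annihilates k (M : lmodType P) (x : M) p :
  annihilated varpow k x -> powideal k p -> p *: x = 0.
Proof.
move=> xk pk; rewrite [p]mpolyE scaler_suml big_seq big1 // => m.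
rewrite mcoeff_msupp => pm.
have [[i ik]|mk] := pselect (exists2 i : 'I_n, (i < k)%N & (t <= m i)%N); last first.
  rewrite pk ?eqxx // in pm => i ik; rewrite ltnNge; apply/negP => ti; apply: mk.
  by exists i.
move=> ti; have -> : m = (m - U_(i) *+ t + U_(i) *+ t)%MM.
  rewrite submK //; apply/mnm_lepP => l; rewrite mulmnE mnm1E.
  by case: eqP => [<-|_]; rewrite ?mul1n ?mul0n.
by rewrite mpolyXD -varpowE scalerAl -scalerA xk // scaler0.
Qed.

Lemma annihilated_hcomp k (M : gmod) d (x : M) :
  annihilated varpow k x -> annihilated varpow k (hcomp d x).
Proof.
move=> xk l lk; have [ln|ln] := ltnP l n; last by rewrite /varpow insubN ?scale0r // -leqNgt.
by rewrite -(hcomp_scaleE _ _ (varpow_homog (Ordinal ln))) xk // hcomp0.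
Qed.

Lemma hcomp_scale_homog (M : gmod) (d c : int) (q : P) (x : M) : hcomp d x = x ->
  hcomp c (q *: x) =
  (\sum_(l < mmeasure mdeg q) if c == l%:Z + d then pihomog mdeg l q else 0) *: x.
Proof.
move=> dx; rewrite {1}(pihomog_partitionE (leqnn (mmeasure mdeg q))) !scaler_suml hcomp_sumr.
apply: eq_bigr => l _; rewrite -(hcomp_scale (pihomogP _ _ _) dx) hcomp_hcomp.
by case: eqP; rewrite ?scale0r // (hcomp_scale (pihomogP _ _ _) dx).
Qed.

Lemma hcomp_scale_shift (M : gmod) (d c : int) (q : P) (x : M) : hcomp d x = x ->
  hcomp c (q *: x) = shift_hcomp d c q *: x.
Proof.
move=> dx; rewrite (hcomp_scale_homog _ _ dx); congr (_ *: _).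
(* The same formula for the generator 1 of P(-d) identifies the coefficient. *)
have d1 : @hcomp R n (gshift R n d) d (1 : P) = 1.
  by rewrite -[X in hcomp X]addr0 [LHS](@shift_hcompE R n d 0) pihomog_dE ?dhomog1.
have := @hcomp_scale_homog (gshift R n d) d c q 1 d1.
by rewrite -[LHS]/(shift_hcomp d c (q * 1)) mulr1 => ->; rewrite -[RHS]/(_ * 1) mulr1.
Qed.

(** Multiplication by the next power embeds P/(first powers) into itself,
    because the sequence is regular; a map to an injective module extends along
    that embedding, and so the elements annihilated by the first powers are
    divisible by the next one. *)
Lemma injective_divisible (E : gmod) (i : 'I_n) (x : E) : ginjective E ->
  annihilated varpow i x -> exists2 z, annihilated varpow i z & varpow i *: z = x.
Proof.
move=> Einj.
have divh (d : int) (y : E) : hcomp d y = y -> annihilated varpow i y ->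
    exists2 z, annihilated varpow i z & varpow i *: z = y.
  (* The quotient of E + B by S is the pushout of E and P/J along the
     multiplication by the i-th power on P/J, for J the ideal of the earlier
     powers; the generator of B is placed so that this map has degree 0. *)
  move=> dy yi; pose B := gshift R n (d - t%:Z).
  pose S (e : gprod E B) := exists q : P,
    powideal i ((e.2 : P) + varpow i * q) /\ e.1 = q *: y.
  have S0 : S 0 by exists 0; rewrite scale0r mulr0 addr0; split=> //; apply: powideal0.
  have SL (a : P) e f : S e -> S f -> S (a *: e + f).
    move=> [q [qi qE]] [r [ri rE]]; exists (a * q + r); split; last first.
      by rewrite /= qE rE scalerDl scalerA.
    move: (powidealL a qi ri); congr powideal.
    by rewrite /= mulrDr mulrDr mulrCA addrACA.
  have SH c e : S e -> S (hcomp c e).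
    move=> [q [qi qE]]; exists (shift_hcomp d c q); split; last first.
      by rewrite /= qE; apply: hcomp_scale_shift.
    have -> : varpow i * shift_hcomp d c q =
        shift_hcomp (d - t%:Z) c (varpow i * q).
      have := @hcomp_scaleE R n B t (varpow i) (c - t%:Z) q (varpow_homog i).
      rewrite addrC subrK => hE; rewrite [RHS]hE -[RHS]/(varpow i * _); congr (_ * _).
      by rewrite /= /shift_hcomp opprB addrA subrK.
    rewrite -[X in powideal _ (X + _)]/(shift_hcomp (d - t%:Z) c e.2).
    rewrite -shift_hcompD /shift_hcomp; case: (_ - _) => l; last exact: powideal0.
    exact: powideal_pihomog.
  have Sker e : S (e, 0) -> e = 0.
    move=> [q [/= qi ->]]; apply: powideal_annihilates yi _.
    by apply: powideal_regular; move: qi; rewrite add0r.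
  have [g gE] := @injective_rel R n E B (GSubmod S0 SL SH) Einj Sker.
  pose one : B := (1 : P); exists (g one) => [l li|].
    rewrite -linearZ -[RHS]oppr0; apply: gE; exists 0; rewrite scale0r; split=> //.
    rewrite mulr0 addr0 -[_.2]/(varpow l * 1) mulr1.
    exact: (@powideal_varpow i (Ordinal (ltn_trans li (ltn_ord i)))).
  apply: oppr_inj; rewrite -scaleNr -linearZ; apply: gE.
  exists 1; rewrite scale1r; split=> //.
  rewrite -[_.2]/(- varpow i * 1) !mulr1 addNr; exact: powideal0.
move=> xi; have [s [_ xE]] := hcomp_sum x.
have /choice[z zP] : forall d, exists z, annihilated varpow i z /\ varpow i *: z = hcomp d x.
  move=> d; have [|z zi zE] := divh d (hcomp d x) _ (annihilated_hcomp d xi).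
    by rewrite hcomp_hcomp eqxx.
  by exists z.
exists (\sum_(d <- s) z d).
  move=> l li; rewrite scaler_sumr big1 // => d _; exact: (zP d).1.
by rewrite scaler_sumr [RHS]xE; apply: eq_bigr => d _; exact: (zP d).2.
Qed.

End RegularSequence.

(** * Cohomology with support in powers of the variables *)

Section Vanishing.
Variables (R : comNzRingType) (n : nat).
Local Notation P := {mpoly R[n]}.
Local Notation gmod := (gmod R n).

Record injcomplex := InjComplex {
  ic_obj :> nat -> gmod;
  ic_d : forall j, ghom (ic_obj j) (ic_obj j.+1);
  ic_inj : forall j, ginjective (ic_obj j);
  ic_dd : forall j x, ic_d j.+1 (ic_d j x) = 0;
  ic_exact : forall j x, ic_d j.+1 x = 0 -> exists y, ic_d j y = x
}.

Definition resolution_complex (M : gmod) (I : ginjres M) : injcomplex :=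
  InjComplex (ir_injective (g := I)) (fun j x => (ir_exact _).2 (ex_intro _ x erefl))
    (fun j x => (@ir_exact _ _ _ I j x).1).

(** The object in degree j - 1, so that the boundaries in all degrees,
    including 0, are the image of one map. *)
Definition prev (C : nat -> gmod) (j : nat) : gmod :=
  match j with 0 => gzero R n | j'.+1 => C j' end.

Definition prev_d (C : nat -> gmod) (d : forall j, ghom (C j) (C j.+1)) (j : nat) :
    ghom (prev C j) (C j) :=
  match j with 0 => gzero_hom (gzero R n) (C 0) | j'.+1 => d j' end.

Lemma gzero_injective : ginjective (gzero R n).
Proof. by move=> A B i f _; exists (gzero_hom B _) => x; apply: gzero_eq. Qed.

Lemma prev_injective (C : injcomplex) j : ginjective (prev C j).
Proof. case: j => [|j]; [exact: gzero_injective | exact: ic_inj]. Qed.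

Lemma prev_d_d (C : nat -> gmod) (d : forall j, ghom (C j) (C j.+1)) :
  (forall j x, d j.+1 (d j x) = 0) -> forall j x, d j (prev_d d j x) = 0.
Proof. by move=> dd [|j] x; [exact: linear0 | exact: dd]. Qed.

Lemma prev_dd (C : injcomplex) j x : ic_d C j (prev_d (ic_d C) j x) = 0.
Proof. exact/prev_d_d/ic_dd. Qed.

Section Complex.
Variables (C : injcomplex) (t : nat).
Local Notation d := (ic_d C).
Local Notation u := (@varpow R n t).
Local Notation annihilated := (annihilated u).

Definition ann_bound (k j : nat) (x : C j) : Prop :=
  exists2 w : prev C j, annihilated k w & prev_d d j w = x.

Definition ann_acyclic (k j : nat) : Prop :=
  forall x : C j, annihilated k x -> d j x = 0 -> ann_bound k x.

(** If u_k kills the boundary d a, then u_k a is a cocycle, hence a boundary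
    d c; as c is divisible by u_k, correcting a by a boundary makes it
    annihilated by u_k itself. *)
Lemma ann_bound_refine (i : 'I_n) j (a : C j) : ann_acyclic i j ->
  annihilated i a -> u i *: d j a = 0 ->
  exists2 w, annihilated i.+1 w & d j w = d j a.
Proof.
move=> acy ai ua; have [|c ci cE] := acy (u i *: a) (annihilatedZ _ ai).
  by rewrite linearZ.
have [c' c'i c'E] := injective_divisible (@prev_injective C j) ci.
exists (a - prev_d d j c'); last by rewrite linearB prev_dd subr0.
apply/annihilatedS; split; first by apply: annihilatedB => //; apply: annihilated_map.
by rewrite scalerBr -linearZ c'E cE subrr.
Qed.

(** Each further power raises the cohomological dimension of the functor of
    annihilated elements by at most one. *)
Lemma ann_acyclic_high k j : (k <= n)%N -> (k < j)%N -> ann_acyclic k j.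
Proof.
elim: k j => [|k IHk] [|j] // kn kj x xk dx.
  by have [y yE] := ic_exact dx; exists y.
have [xk' ux] := (annihilatedS _ _ _).1 xk.
have [a ak aE] := IHk j.+1 (ltnW kn) (ltnW kj) x xk' dx.
have [|w wk wE] := @ann_bound_refine (Ordinal kn) j a (IHk j (ltnW kn) kj) ak.
  by rewrite [d j a]aE.
by exists w; rewrite // wE.
Qed.

Section Depth.
Variables (F : gmod) (eps : ghom F (C 0)).
Hypothesis eps_inj : injective eps.
Hypothesis eps_exact : forall x, d 0 x = 0 <-> exists m, eps m = x.

(** The submodule (u_0, ..., u_(k-1))F, in the recursive form that matches the
    recursion of [connected] below. *)
Fixpoint powspan (k : nat) (m : F) : Prop :=
  match k with 0 => m = 0 | k'.+1 => exists m', powspan k' (m - u k' *: m') end.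

Hypothesis F_regular : forall i : 'I_n, forall m, powspan i (u i *: m) -> powspan i m.

(** The cohomology of degree k of the elements annihilated by u_0, ...,
    u_(k-1) is F/(u_0, ..., u_(k-1))F: this is the k-fold composite of
    connecting maps of multiplication by the u_l, as a relation. *)
Fixpoint connected (k : nat) (m : F) : C k -> Prop :=
  match k with
  | 0 => fun x => eps m = x
  | k'.+1 => fun x =>
      exists w, [/\ annihilated k' w, d k' w = x & connected m (u k' *: w)]
  end.

Lemma connectedL k (a : P) m m' (x x' : C k) :
  connected m x -> connected m' x' -> connected (a *: m + m') (a *: x + x').
Proof.
elim: k x x' => [|k IHk] x x' /=; first by move=> <- <-; rewrite linearP.
move=> [w [wk <- mw]] [w' [wk' <- mw']]; exists (a *: w + w'); split.
- exact: annihilatedL.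
- by rewrite linearP.
- by rewrite scalerDr scalerA mulrC -scalerA; apply: IHk.
Qed.

Lemma connectedZ k (a : P) m (x : C k) : connected m x -> connected (a *: m) (a *: x).
Proof.
move=> mx; rewrite -[a *: m]addr0 -[a *: x]addr0; apply: connectedL => //.
by move: (connectedL (-1) mx mx); rewrite !scaleN1r !addNr.
Qed.

Lemma connectedB k m m' (x x' : C k) :
  connected m x -> connected m' x' -> connected (m - m') (x - x').
Proof. by move=> mx mx'; move: (connectedL (-1) mx' mx); rewrite !scaleN1r ![- _ + _]addrC. Qed.

Lemma connected_cocycle k m (x : C k) : connected m x -> annihilated k x /\ d k x = 0.
Proof.
elim: k x => [|k IHk] x /=; first by move=> <-; split=> //; apply/eps_exact; exists m.
move=> [w [wk <- /IHk[_ dw]]]; split; last exact: ic_dd.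
by apply/annihilatedS; split; [exact: annihilated_map | rewrite -linearZ].
Qed.

Lemma cocycle_connected k (x : C k) : (k <= n)%N ->
  annihilated k x -> d k x = 0 -> exists m, connected m x.
Proof.
elim: k x => [|k IHk] x kn xk dx; first exact/eps_exact.
have [xk' ux] := (annihilatedS _ _ _).1 xk.
have [w wk wx] := @ann_acyclic_high k k.+1 (ltnW kn) (ltnSn k) x xk' dx.
have [||m mw] := IHk (u k *: w) (ltnW kn); first exact: annihilatedZ.
  by rewrite linearZ [d k w]wx.
by exists m, w.
Qed.

Lemma connected_exists k m : (k <= n)%N -> exists x : C k, connected m x.
Proof.
elim: k => [|k IHk] kn; first by exists (eps m).
have [x mx] := IHk (ltnW kn); have [xk _] := connected_cocycle mx.
have [w wk wx] := injective_divisible (i := Ordinal kn) (@ic_inj C k) xk.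
by exists (d k w), w; rewrite [u k *: w]wx.
Qed.

(** The relation [connected] identifies cohomology classes with classes modulo
    [powspan]: two choices of w differ by a cocycle, whose class comes from
    some m', and this moves m by u_k m'. *)
Lemma connected_bound k m (x : C k) : (k <= n)%N -> connected m x ->
  ann_bound k x <-> powspan k m.
Proof.
elim: k m x => [|k IHk] m x kn.
  move=> /= <-; split=> [[w _ /= wm]|->].
    by apply: eps_inj; rewrite linear0 -wm.
  by exists 0; rewrite ?linear0 //; apply: annihilated0.
move=> [w [wk wx mw]]; split.
  move=> [v /annihilatedS[vk uv] vx].
  have [||m' mw'] := @cocycle_connected k (w - v) (ltnW kn); first exact: annihilatedB.
    by rewrite linearB wx [d k v]vx subrr.
  exists m'; apply/(IHk _ 0 (ltnW kn)); last first.
    by exists 0; rewrite ?linear0 //; apply: annihilated0.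
  have := connectedB mw (connectedZ (u k) mw').
  by rewrite scalerBr uv subr0 subrr.
move=> [m' mm']; have [w' mw'] := connected_exists m' (ltnW kn).
have := connectedB mw (connectedZ (u k) mw'); rewrite -scalerBr.
move=> /(IHk _ _ (ltnW kn))/iffRL/(_ mm')[v vk vE].
have [w'k dw'] := connected_cocycle mw'.
have [v' v'k v'E] := injective_divisible (i := Ordinal kn) (@prev_injective C k) vk.
exists (w - w' - prev_d d k v'); last first.
  by rewrite /= !linearB wx dw' prev_dd !subr0.
apply/annihilatedS; split.
  by apply: annihilatedB; [exact: annihilatedB | exact: annihilated_map].
by rewrite scalerBr -linearZ [u k *: v']v'E vE subrr.
Qed.

(** In degree j = k the multiplication by u_k is injective on cohomology,
    because it is injective on F/(u_0, ..., u_(k-1))F; so a class that it kills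
    is 0, and the step from k to k + 1 creates no cohomology below degree
    k + 1. *)
Lemma ann_acyclic_low k j : (k <= n)%N -> (j < k)%N -> ann_acyclic k j.
Proof.
elim: k j => // k IHk j kn jk x /annihilatedS[xk ux] dx.
have [a ak ax] : ann_bound k x.
  move: jk; rewrite ltnS leq_eqVlt => /predU1P[jk|jk]; last exact: IHk (ltnW kn) jk x xk dx.
  rewrite {}jk in x xk ux dx *.
  have [m mx] := cocycle_connected (ltnW kn) xk dx.
  apply/(connected_bound (ltnW kn) mx)/(F_regular (i := Ordinal kn)).
  apply/(connected_bound (ltnW kn) (connectedZ (u k) mx)).
  by rewrite ux; exists 0; rewrite ?linear0 //; apply: annihilated0.
case: j jk x xk ux dx a ak ax => [|j] jk x xk ux dx a ak ax.
  by exists a => // l _; apply: gzero_eq.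
have [|w wk wE] := @ann_bound_refine (Ordinal kn) j a (IHk j (ltnW kn) jk) ak.
  by rewrite [d j a]ax.
by exists w; rewrite // wE.
Qed.

End Depth.
End Complex.

(** On a free module with basis e, the span of the multiples of the powers
    consists of the vectors with coordinates in the monomial ideal, so the
    powers are a regular sequence on it as they are on P. *)
Lemma gfree_regular (t : nat) (F : gmod) : gfree F ->
  forall (i : 'I_n) (m : F), powspan t i (varpow R n t i *: m) -> powspan t i m.
Proof.
move=> [r [e [_ [_ eP]]]].
have /choice[c cP] : forall m : F, exists c : {ffun 'I_r -> P},
    m = \sum_j c j *: e j /\ forall c' : {ffun 'I_r -> P}, m = \sum_j c' j *: e j -> c = c'.
  by move=> m; have [c [cE cu]] := eP m; exists c.
have cL (a : P) m m' j : c (a *: m + m') j = a * c m j + c m' j.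
  pose c' := [ffun j => a * c m j + c m' j].
  rewrite ((cP _).2 c') ?ffunE // {1}(cP m).1 {1}(cP m').1 scaler_sumr -big_split.
  by apply: eq_bigr => k _; rewrite ffunE scalerDl scalerA.
have c0 j : c 0 j = 0.
  by apply: (addrI (c 0 j)); rewrite addr0 -[X in X + _]mul1r -cL scale1r addr0.
have cZ (a : P) m j : c (a *: m) j = a * c m j by rewrite -[a *: m]addr0 cL c0 addr0.
have spanP k m : (k <= n)%N -> powspan t k m <-> forall j, powideal t k (c m j).
  elim: k m => [|k IHk] m kn /=.
    split=> [-> j|m0]; first by rewrite c0; apply: powideal0.
    rewrite (cP m).1 big1 // => j _; rewrite [c m j](_ : _ = 0) ?scale0r //.
    by apply/mpolyP => s; rewrite mcoeff0; apply: m0.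
  have cB m' j : c (m - varpow R n t k *: m') j = c m j - varpow R n t k * c m' j.
    by rewrite addrC -scaleNr cL mulNr addrC.
  split=> [[m' /IHk mk] j|mk].
    rewrite -[c m j](subrK (varpow R n t k * c m' j)) -cB; apply: powidealD.
      exact/powidealS/mk/ltnW.
    rewrite mulrC; apply: powidealM; exact: (@powideal_varpow _ _ _ _ (Ordinal kn)).
  have /choice[q qP] : forall j, exists q, powideal t k (c m j - varpow R n t k * q).
    by move=> j; apply: (@powideal_succ _ _ _ (Ordinal kn)); apply: mk.
  exists (\sum_j q j *: e j); apply/(IHk _ (ltnW kn)) => j.
  rewrite cB; suff -> : c (\sum_j q j *: e j) = [ffun j => q j] by rewrite ffunE.
  by apply: (cP _).2; apply: eq_bigr => l _; rewrite ffunE.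
move=> i m /(spanP _ _ (ltnW (ltn_ord i))) um; apply/(spanP _ _ (ltnW (ltn_ord i))) => j.
by apply: powideal_regular; rewrite -cZ.
Qed.

End Vanishing.

(** * Torsion cohomology *)

Section Torsion.
Variables (R : comNzRingType) (n : nat).
Local Notation P := {mpoly R[n]}.
Local Notation gmod := (gmod R n).

(** A monomial of degree above n t has an exponent at least t, so the powers
    of the irrelevant ideal and the ideals of powers of the variables are
    cofinal. *)
Lemma torsionP (M : gmod) (x : M) :
  torsion_mem x <-> exists t, annihilated (varpow R n t) n x.
Proof.
split=> [[k kx]|[t xt]].
  exists k => l ln; rewrite -[l]/(nat_of_ord (Ordinal ln)) /varpow valK.
  have := kx (fun _ => 'X_(Ordinal ln)) (fun _ => Pplus_X _ _).
  by rewrite prodr_const card_ord.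
exists (n * t).+1 => a /Pplus_prod[c ->]; rewrite scaler_suml big1 // => f _.
apply: powideal_annihilates xt _; apply: powidealM => m mt.
have /dhomogP Xh := Xprod_homog R f.
apply: memN_msupp_eq0; apply/negP => /Xh /= mK.
have : (mdeg m <= \sum_(i < n) t)%N.
  by rewrite mdegE; apply: leq_sum => i _; apply/ltnW/mt.
by rewrite sum_nat_const card_ord mK ltnn.
Qed.

Lemma torsion_pair (M N : gmod) (z : gprod M N) :
  torsion_mem z.1 -> torsion_mem z.2 -> torsion_mem z.
Proof.
case: z => x y [k kx] [l ly]; exists (k + l)%N => a aP.
by congr pair; rewrite /= ?(killedW l kx).1 ?(killedW k ly).2.
Qed.

Lemma torsion_fst (M N : gmod) (z : gprod M N) : torsion_mem z -> torsion_mem z.1.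
Proof. by case=> k kz; exists k => a aP; move: (kz a aP) => /(congr1 fst). Qed.

Lemma torsion_snd (M N : gmod) (z : gprod M N) : torsion_mem z -> torsion_mem z.2.
Proof. by case=> k kz; exists k => a aP; move: (kz a aP) => /(congr1 snd). Qed.

Lemma torsionB (M : gmod) (x y : M) : torsion_mem x -> torsion_mem y -> torsion_mem (x - y).
Proof. by move=> tx ty; rewrite addrC -scaleN1r; apply: torsion_linear. Qed.

Lemma torsionN (M : gmod) (x : M) : torsion_mem x -> torsion_mem (- x).
Proof. by move=> tx; rewrite -[- x]add0r; apply: torsionB => //; apply: torsion0. Qed.

Section Bounds.
Variables (C : nat -> gmod) (d : forall j, ghom (C j) (C j.+1)).

Definition tors_cocycle (j : nat) (x : C j) : Prop := torsion_mem x /\ d j x = 0.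

Definition tors_bound (j : nat) (x : C j) : Prop :=
  exists2 w : prev C j, torsion_mem w & prev_d d j w = x.

Definition tors_acyclic (j : nat) : Prop :=
  forall x : C j, tors_cocycle x -> tors_bound x.

Lemma tors_bound0 j : tors_bound (0 : C j).
Proof. by exists 0; [exact: torsion0 | rewrite linear0]. Qed.

Lemma tors_boundL j (a : P) (x y : C j) :
  tors_bound x -> tors_bound y -> tors_bound (a *: x + y).
Proof.
move=> [v tv <-] [w tw <-]; exists (a *: v + w); first exact: torsion_linear.
by rewrite linearP.
Qed.

Lemma tors_boundB j (x y : C j) : tors_bound x -> tors_bound y -> tors_bound (x - y).
Proof. by move=> bx bv; rewrite addrC -scaleN1r; apply: tors_boundL. Qed.

Lemma tors_boundN j (x : C j) : tors_bound x -> tors_bound (- x).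
Proof. by move=> bx; rewrite -[- x]add0r; apply: tors_boundB => //; apply: tors_bound0. Qed.

Lemma tors_boundD j (x y : C j) : tors_bound x -> tors_bound y -> tors_bound (x + y).
Proof. by move=> bx bv; rewrite -[y]opprK; apply: tors_boundB => //; apply: tors_boundN. Qed.

Lemma tors_bound_hcomp j c (x : C j) : tors_bound x -> tors_bound (hcomp c x).
Proof.
by move=> [w tw <-]; exists (hcomp c w); [exact: torsion_hcomp | rewrite ghom_hcomp].
Qed.

End Bounds.

Lemma tors_bound_map (C D : nat -> gmod) (dC : forall j, ghom (C j) (C j.+1))
    (dD : forall j, ghom (D j) (D j.+1)) (f : forall j, ghom (C j) (D j)) :
  (forall j x, f j.+1 (dC j x) = dD j (f j x)) ->
  forall j x, tors_bound dC x -> tors_bound dD (f j x).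
Proof.
move=> fd [|j] x [w tw <-]; first by rewrite linear0; apply: tors_bound0.
by exists (f j w); [exact: torsion_map | rewrite /= -fd].
Qed.

Lemma tors_acyclic_high (C : injcomplex R n) j : (n < j)%N -> tors_acyclic (ic_d C) j.
Proof.
move=> nj x [/torsionP[t xt] dx].
have [w wt wE] := ann_acyclic_high (leqnn n) nj xt dx.
by exists w => //; apply/torsionP; exists t.
Qed.

Lemma tors_acyclic_low (F : gmod) (I : ginjres F) j : gfree F -> (j < n)%N ->
  tors_acyclic (ir_d I) j.
Proof.
move=> Ffree nj x [/torsionP[t xt] dx].
have [w wt wE] := @ann_acyclic_low R n (resolution_complex I) t F _ (@ir_eps_inj _ _ _ I)
  (@ir_exact0 _ _ _ I) (gfree_regular Ffree) _ _ (leqnn n) nj x xt dx.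
by exists w => //; apply/torsionP; exists t.
Qed.

End Torsion.

(** * Null-homotopies and cones *)

Section Homotopy.
Variables (R : comNzRingType) (n : nat).
Local Notation gmod := (gmod R n).

(** The homotopy is built degree by degree.  What is carried along is that
    f - d s vanishes on cycles, which is what allows it to factor through the
    next differential; that differential is injective modulo cycles, so the
    factorization extends to the next object by injectivity. *)
Lemma null_homotopy (X : nat -> gmod) (dX : forall j, ghom (X j) (X j.+1))
    (Y : nat -> gmod) (dY : forall j, ghom (Y j) (Y j.+1)) (f : forall j, ghom (X j) (Y j)) :
  (forall j, ginjective (Y j)) -> (forall j x, dY j.+1 (dY j x) = 0) ->
  (forall j x, dX j x = 0 -> exists y, prev_d dX j y = x) ->
  (forall j x, f j.+1 (dX j x) = dY j (f j x)) ->
  exists s : forall j, ghom (X j) (prev Y j),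
    forall j x, s j.+1 (dX j x) = f j x - prev_d dY j (s j x).
Proof.
move=> Yinj dd Xex fd.
pose partial j (s : ghom (X j) (prev Y j)) :=
  forall x, dX j x = 0 -> f j x = prev_d dY j (s x).
pose T j := {s : ghom (X j) (prev Y j) | partial j s}.
have step j (s : T j) : exists s' : T j.+1,
    forall x, sval s' (dX j x) = f j x - prev_d dY j (sval s x).
  case: s => s sP.
  have [h hE] : exists h : ghom (X j) (Y j),
      h =1 (fun x => f j x - prev_d dY j (s x)).
    apply: ghom_of => [a x y|c x]; last by rewrite !ghom_hcomp hcompD hcompN.
    by rewrite !linearP scalerDr addrACA.
  have [|s' s'E] := injective_extend (h := h) (d := dX j) (Yinj j).
    by move=> x dx; rewrite hE (sP x dx) subrr.
  have s'P : partial j.+1 s'.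
    move=> x /Xex[y /= <-]; rewrite s'E hE fd linearB [X in _ - X](prev_d_d dd).
    by rewrite subr0.
  by exists (exist _ s' s'P) => x /=; rewrite s'E hE.
have T0 : T 0.
  exists (gzero_hom _ _) => x /Xex[y <-]; by rewrite /= linear0.
pose S := nat_rect T T0 (fun j s => sval (cid (step j s))).
exists (fun j => sval (S j)) => j x.
exact: (svalP (cid (step j (S j)))).
Qed.

Section Cone.
Variables (X Y : injcomplex R n) (psi : forall j, ghom (X j) (Y j)).
Hypothesis psi_d : forall j x, psi j.+1 (ic_d X j x) = ic_d Y j (psi j x).
Hypothesis psi_H0 : forall y, ic_d Y 0 y = 0 -> exists2 x, ic_d X 0 x = 0 & psi 0 x = y.

Definition cone_obj j : gmod := gprod (X j) (prev Y j).

Definition cone_fun j (z : cone_obj j) : cone_obj j.+1 :=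
  (ic_d X j z.1, psi j z.1 - prev_d (ic_d Y) j z.2).

Lemma cone_linear j : linear (@cone_fun j).
Proof.
move=> a x y; congr pair; rewrite /= !linearP //.
by rewrite scalerDr addrACA.
Qed.

Lemma cone_hcomp j c z : @cone_fun j (hcomp c z) = hcomp c (@cone_fun j z).
Proof. by congr pair; rewrite /= !ghom_hcomp // hcompD hcompN. Qed.

Definition cone_d j : ghom (cone_obj j) (cone_obj j.+1) :=
  mk_ghom (@cone_linear j) (@cone_hcomp j).

Lemma gprod_injective (A B : gmod) : ginjective A -> ginjective B -> ginjective (gprod A B).
Proof.
move=> Ai Bi U V i f ii.
have [f1 f1E] : exists f1 : ghom U A, f1 =1 (fun x => (f x).1).
  by apply: ghom_of => [a x y|c x]; rewrite ?linearP ?ghom_hcomp.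
have [f2 f2E] : exists f2 : ghom U B, f2 =1 (fun x => (f x).2).
  by apply: ghom_of => [a x y|c x]; rewrite ?linearP ?ghom_hcomp.
have [g1 g1E] := Ai _ _ i f1 ii; have [g2 g2E] := Bi _ _ i f2 ii.
have [g gE] : exists g : ghom V (gprod A B), g =1 (fun x => (g1 x, g2 x)).
  apply: ghom_of => [a x y|c x]; by congr pair; rewrite ?linearP ?ghom_hcomp.
by exists g => x; rewrite gE g1E g2E f1E f2E -surjective_pairing.
Qed.

Lemma cone_injective j : ginjective (cone_obj j).
Proof. apply: gprod_injective; [exact: ic_inj | exact: prev_injective]. Qed.

Lemma cone_dd j z : cone_d j.+1 (cone_d j z) = 0.
Proof.
congr pair; first exact: ic_dd.
by rewrite /= psi_d linearB prev_dd subr0 subrr.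
Qed.

Lemma cone_exact j z : cone_d j.+1 z = 0 -> exists y, cone_d j y = z.
Proof.
case: z => a b [da] /eqP; rewrite subr_eq0 => /eqP /= ab.
have [a0 a0E] := ic_exact da.
have : ic_d Y j (psi j a0 - b) = 0 by rewrite linearB -psi_d a0E ab subrr.
case: j a b da ab a0 a0E => [|j] a b da ab a0 a0E.
  move=> /psi_H0[x dx xE]; exists (a0 - x, 0); congr pair => /=.
    by rewrite linearB dx subr0.
  by rewrite [LHS]subr0 linearB xE opprB addrC subrK.
move=> /ic_exact[c cE]; exists (a0, c); congr pair => //=.
by rewrite cE opprB addrC subrK.
Qed.

(** The cone of psi, in the degrees that make it a resolution of the kernel of
    the map that psi lifts, provided that that map is surjective. *)
Definition cone : injcomplex R n := InjComplex cone_injective cone_dd cone_exact.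

Definition cone_in j (x : Y j) : cone j.+1 := (0, x).

Lemma cone_in_cocycle j (x : Y j) :
  tors_cocycle (ic_d Y) x -> tors_cocycle (ic_d cone) (cone_in x).
Proof.
move=> [tx dx]; split; first by apply: torsion_pair => //; apply: torsion0.
by congr pair; rewrite /= linear0 // dx subrr.
Qed.

Lemma cone_in_bound j (x : Y j) :
  tors_bound (ic_d Y) x -> tors_bound (ic_d cone) (cone_in x).
Proof.
move=> [w tw wE]; exists (0, - w).
  by apply: torsion_pair; [exact: torsion0 | exact: torsionN].
by congr pair; rewrite /= linear0 // linearN opprK add0r.
Qed.

Lemma cone_in_bound_inv j (x : Y j) : tors_acyclic (ic_d X) j ->
  tors_bound (ic_d cone) (cone_in x) -> tors_bound (ic_d Y) x.
Proof.
move=> Xacy [[a w] tz [da <-]].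
have /(tors_bound_map psi_d) pb : tors_bound (ic_d X) a.
  by apply: Xacy; split=> //; apply: (torsion_fst tz).
by apply: tors_boundB => //; exists w => //; apply: (torsion_snd tz).
Qed.

Lemma cone_in_onto j (z : cone j.+1) : tors_cocycle (ic_d cone) z ->
  tors_bound (ic_d X) z.1 ->
  exists2 x : Y j, tors_cocycle (ic_d Y) x & tors_bound (ic_d cone) (z - cone_in x).
Proof.
case: z => a b [tz [da /eqP]]; rewrite subr_eq0 => /eqP /= ab [a0 ta0 /= a0E].
exists (b - psi j a0).
  split; first by apply: torsionB; [exact: (torsion_snd tz) | exact: torsion_map].
  by rewrite linearB -ab -psi_d a0E subrr.
exists (a0, 0); first by apply: torsion_pair => //; apply: torsion0.
congr pair; rewrite /= ?subr0 //.
by rewrite linear0 subr0 opprB addrC subrK.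
Qed.

(** The connecting map of a cone is induced by psi, so this lemma and the next
    are the exactness of the long exact cohomology sequence at the target and
    at the source of psi; the lemmas on [cone_in] are its exactness on either
    side of the map induced by the inclusion. *)
Lemma psi_onto j (x : Y j) : tors_acyclic (ic_d cone) j.+1 -> tors_cocycle (ic_d Y) x ->
  exists2 y : X j, tors_cocycle (ic_d X) y & tors_bound (ic_d Y) (psi j y - x).
Proof.
move=> acy /cone_in_cocycle /acy[[a w] tz [da xE]].
exists a; first by split=> //; apply: (torsion_fst tz).
exists w; first exact: (torsion_snd tz).
by rewrite -xE opprB addrC subrK.
Qed.

Lemma psi_kernel j (y : X j) : tors_cocycle (ic_d X) y -> tors_bound (ic_d Y) (psi j y) ->
  exists2 z : cone j, tors_cocycle (ic_d cone) z & z.1 = y.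
Proof.
move=> [ty dy] [w tw wE]; exists (y, w) => //; split; first exact: torsion_pair.
by congr pair; rewrite /= // wE subrr.
Qed.

Lemma cone_fst_bound j (z : cone j) : tors_bound (ic_d cone) z -> tors_bound (ic_d X) z.1.
Proof.
case: j z => [|j] z [w tw <-]; first exact: tors_bound0.
by exists w.1; first exact: torsion_fst.
Qed.

End Cone.
End Homotopy.

(** * Classes in homology *)

Section Classes.
Variables (R : comNzRingType) (n : nat).
Local Notation P := {mpoly R[n]}.
Local Notation gmod := (gmod R n).

Section Homology.
Variables (A B C : gmod) (f : ghom A B) (g : ghom B C).

(** Homology classes are handled through the relation with the cycles that
    represent them; this also serves for the iterated quotients below, without
    choosing representatives. *)
Definition hclass (h : homology f g) (z : B) : Prop :=
  exists2 c : gsub (gker g), val c = z & gpi (gbound f g) c = h.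

Lemma hclass_rep h : exists z, hclass h z.
Proof. by exists (val (grepr h)), (grepr h) => //; apply: gpi_repr. Qed.

Lemma hclass_cycle h z : hclass h z -> g z = 0.
Proof. by move=> [c <- _]; apply: (gsub_memP c). Qed.

Lemma hclass_of z : g z = 0 -> exists h, hclass h z.
Proof.
move=> gz; pose c : gsub (gker g) := gsub_in (S := gker g) gz.
by exists (gpi (gbound f g) c), c.
Qed.

Lemma hclassL (a : P) h h' z z' : hclass h z -> hclass h' z' ->
  hclass (a *: h + h') (a *: z + z').
Proof.
by move=> [c <- <-] [c' <- <-]; exists (a *: c + c'); rewrite ?linearP.
Qed.

Lemma hclass_hcomp d h z : hclass h z -> hclass (hcomp d h) (hcomp d z).
Proof.
by move=> [c <- <-]; exists (hcomp d c) => //; rewrite [RHS]gquot_hcomp_pi.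
Qed.

Lemma hclass_eq0 h z : hclass h z -> h = 0 <-> exists x, f x = z.
Proof.
move=> [c <- <-]; rewrite -(linear0 (gpi (gbound f g))).
by split=> [/gpiP|cb]; [rewrite subr0 | apply/gpiP; rewrite subr0].
Qed.

End Homology.

Lemma hclass_map (A B C A' B' C' : gmod) (f : ghom A B) (g : ghom B C)
    (f' : ghom A' B') (g' : ghom B' C') (a : ghom A A') (b : ghom B B') (c : ghom C C')
    (ab : forall x, b (f x) = f' (a x)) (bc : forall x, c (g x) = g' (b x))
    (h : homology f g) z :
  hclass h z -> hclass (homology_map ab bc h) (b z).
Proof.
move=> [v <- <-]; exists (gsub_hom (gker_map bc) v) => //.
symmetry; exact: (gquot_map_pi (gbound_map ab bc)).
Qed.

Section Cohomology.
Variables (C : nat -> gmod) (d : forall j, ghom (C j) (C j.+1)).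

Definition tors_cohomology (j : nat) : gmod :=
  cohomology (C := fun j => Gamma (C j)) (fun j => Gamma_hom (d j)) j.

(** Cohomology in degree 0 and in positive degree are given by different
    expressions; this relation and the lemmas on it treat them alike. *)
Definition cclass (j : nat) : tors_cohomology j -> C j -> Prop :=
  match j with
  | 0 => fun h x => exists2 c : Gamma (C 0), val c = x & hclass h c
  | j'.+1 => fun h x => exists2 c : Gamma (C j'.+1), val c = x & hclass h c
  end.

Lemma cclass_rep j (h : tors_cohomology j) : exists x, cclass h x.
Proof. by case: j h => [|j] h; have [c hc] := hclass_rep h; exists (val c), c. Qed.

Lemma cclass_cocycle j (h : tors_cohomology j) x : cclass h x -> tors_cocycle d x.
Proof.
by case: j h x => [|j] h x [c <- /hclass_cycle/(congr1 val) dc];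
  split=> //; exact: (@gsub_memP _ _ _ (torsion _) c).
Qed.

Lemma cclass_of j x : tors_cocycle d x -> exists h : tors_cohomology j, cclass h x.
Proof.
case: j x => [|j] x [tx dx]; pose c : Gamma (C _) := gsub_in (S := torsion _) tx.
  have [|h hc] := @hclass_of _ _ _ (gzero_hom (gzero R n) (Gamma (C 0)))
    (Gamma_hom (d 0)) c.
    by apply: val_inj.
  by exists h, c.
have [|h hc] := @hclass_of _ _ _ (Gamma_hom (d j)) (Gamma_hom (d j.+1)) c.
  by apply: val_inj.
by exists h, c.
Qed.

Lemma cclassL j (a : P) (h h' : tors_cohomology j) x x' :
  cclass h x -> cclass h' x' -> cclass (a *: h + h') (a *: x + x').
Proof.
by case: j h h' x x' => [|j] h h' x x' [c <- hc] [c' <- hc'];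
  exists (a *: c + c') => //; apply: hclassL.
Qed.

Lemma cclassB j (h h' : tors_cohomology j) x x' :
  cclass h x -> cclass h' x' -> cclass (h - h') (x - x').
Proof. by move=> hx hx'; move: (cclassL (-1) hx' hx); rewrite !scaleN1r ![- _ + _]addrC. Qed.

Lemma cclass_hcomp j c (h : tors_cohomology j) x :
  cclass h x -> cclass (hcomp c h) (hcomp c x).
Proof.
by case: j h x => [|j] h x [z <- hz]; exists (hcomp c z) => //; apply: hclass_hcomp.
Qed.

Lemma cclass_eq0 j (h : tors_cohomology j) x : cclass h x -> h = 0 <-> tors_bound d x.
Proof.
case: j h x => [|j] h x [c <- /hclass_eq0 ->].
  split=> [[w <-]|[w _ wc]]; first exact: tors_bound0.
  by exists 0; apply: val_inj; rewrite -wc.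
split=> [[w <-]|[w tw wc]].
  by exists (val w) => //; exact: (@gsub_memP _ _ _ (torsion _) w).
by exists (gsub_in (S := torsion _) tw); apply: val_inj.
Qed.

Lemma cclass_eq j (h h' : tors_cohomology j) x x' : cclass h x -> cclass h' x' ->
  h = h' <-> tors_bound d (x - x').
Proof.
move=> hx hx'; rewrite -(cclass_eq0 (cclassB hx hx')).
by split=> [->|/subr0_eq //]; rewrite subrr.
Qed.

End Cohomology.

Lemma cclass_map (M N : gmod) (I : ginjres M) (J : ginjres N) (f : ghom M N)
    (phi : ginjres_lift I J f) j (h : tors_cohomology (ir_d I) j) x :
  cclass h x -> cclass (local_cohomology_map phi j h : tors_cohomology (ir_d J) j) (phi j x).
Proof.
by case: j h x => [|j] h x [c <- hc]; exists (Gamma_hom (phi _) c) => //; apply: hclass_map.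
Qed.

End Classes.

(** * Resolutions of the syzygies *)

Section Tower.
Variables (R : comNzRingType) (n : nat).
Local Notation gmod := (gmod R n).
Variables (M : gmod) (F : gfreeres M) (IM : ginjres M) (IF : forall k, ginjres (F k)).
Variable phi : forall k, ginjres_lift (IF k.+1) (IF k) (fr_d F k).

Local Notation IC k := (resolution_complex (IF k)).

Section Augmented.
Variables (N : gmod) (I : ginjres N).

Definition augmented (j : nat) : gmod := match j with 0 => N | j'.+1 => I j' end.

Definition augmented_d j : ghom (augmented j) (augmented j.+1) :=
  match j with 0 => ir_eps I | j'.+1 => ir_d I j' end.

Lemma augmented_exact j x : augmented_d j x = 0 -> exists y, prev_d augmented_d j y = x.
Proof.
case: j x => [|[|j]] x /=; last exact: (ir_exact _).1; last exact: (ir_exact0 _).1.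
by move=> ix; exists 0; apply: (@ir_eps_inj _ _ _ I); rewrite ix !linear0.
Qed.

End Augmented.

Lemma gneg_hcomp (A B : gmod) (f : ghom A B) c x : - f (hcomp c x) = hcomp c (- f x).
Proof. by rewrite ghom_hcomp hcompN. Qed.

Lemma gneg_linear (A B : gmod) (f : ghom A B) : linear (fun x => - f x).
Proof. by move=> a x y; rewrite linearP opprD scalerN. Qed.

Definition gneg (A B : gmod) (f : ghom A B) : ghom A B :=
  mk_ghom (gneg_linear f) (gneg_hcomp f).

(** A stage of the tower: an injective resolution of the k-th syzygy (M itself
    for k = 0), together with a lift of the surjection from F_k to that
    syzygy.  The syzygy itself is not mentioned: it is the image of psi_0 \o
    eps, and also the kernel of the differential in degree 0. *)
Record stage (k : nat) := Stage {
  st_cx :> injcomplex R n;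
  st_psi : forall j, ghom (IC k j) (st_cx j);
  st_psi_d : forall j x, st_psi j.+1 (ic_d (IC k) j x) = ic_d st_cx j (st_psi j x);
  st_ker_d : forall y, ic_d st_cx 0 y = 0 -> exists m, st_psi 0 (ir_eps (IF k) m) = y;
  st_ker_psi : forall m, st_psi 0 (ir_eps (IF k) m) = 0 <-> exists y, fr_d F k y = m
}.

Lemma lift_augmentation : exists psi : forall j, ghom (IF 0 j) (IM j),
  (forall m, psi 0 (ir_eps (IF 0) m) = ir_eps IM (fr_aug F m)) /\
  forall j x, psi j.+1 (ir_d (IF 0) j x) = ir_d IM j (psi j x).
Proof.
have [f0 f0E] : exists f0 : ghom (F 0) (IM 0), f0 =1 (fun m => ir_eps IM (fr_aug F m)).
  by apply: ghom_of => [a x y|c x]; rewrite ?linearP ?ghom_hcomp.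
(* A lift is a null-homotopy of the map that is eps in degree 0 and zero
   elsewhere, from the augmented complex: with the negative of the
   differential of IM, the relation s d = f - d s says in positive degrees
   that the squares commute. *)
pose f j : ghom (augmented (IF 0) j) (IM j) :=
  match j with 0 => f0 | j'.+1 => gzero_hom (IF 0 j') (IM j'.+1) end.
pose dn j := gneg (ir_d IM j).
have dd j x : dn j.+1 (dn j x) = 0.
  by rewrite /= linearN opprK; apply/ir_exact; exists x.
have fd j x : f j.+1 (augmented_d (IF 0) j x) = dn j (f j x).
  case: j x => [|j] x /=; last by rewrite linear0 oppr0.
  by rewrite f0E (ir_exact0 _).2 ?oppr0 //; eexists.
have [s sE] := null_homotopy (@ir_injective _ _ _ IM) dd (@augmented_exact _ (IF 0)) fd.
exists (fun j => s j.+1); split=> [m|j x].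
  by rewrite [LHS](sE 0 m) f0E [LHS]subr0.
by rewrite [LHS](sE j.+1 x) /= sub0r opprK.
Qed.

Definition aug_lift : forall j, ghom (IF 0 j) (IM j) := sval (cid lift_augmentation).

Lemma aug_lift_eps m : aug_lift 0 (ir_eps (IF 0) m) = ir_eps IM (fr_aug F m).
Proof. exact: (svalP (cid lift_augmentation)).1. Qed.

Lemma aug_lift_d j x : aug_lift j.+1 (ir_d (IF 0) j x) = ir_d IM j (aug_lift j x).
Proof. exact: (svalP (cid lift_augmentation)).2. Qed.

Lemma aug_lift_ker_d y : ir_d IM 0 y = 0 -> exists m, aug_lift 0 (ir_eps (IF 0) m) = y.
Proof.
move=> /ir_exact0[m <-]; have [x <-] := @fr_aug_surj _ _ _ F m.
by exists x; apply: aug_lift_eps.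
Qed.

Lemma aug_lift_ker m :
  aug_lift 0 (ir_eps (IF 0) m) = 0 <-> exists y, fr_d F 0 y = m.
Proof.
rewrite -(fr_exact0 m) aug_lift_eps; split=> [e|->]; last exact: linear0.
by apply: (@ir_eps_inj _ _ _ IM); rewrite e linear0.
Qed.

Definition stage0 : stage 0 :=
  @Stage 0 (resolution_complex IM) aug_lift aug_lift_d aug_lift_ker_d aug_lift_ker.

Section Next.
Variables (k : nat) (S : stage k).

Lemma st_H0 y : ic_d S 0 y = 0 -> exists2 x, ic_d (IC k) 0 x = 0 & st_psi S 0 x = y.
Proof.
by move=> /(st_ker_d (s := S))[m mE]; exists (ir_eps (IF k) m) => //; apply/ir_exact0; exists m.
Qed.

Definition next_cx : injcomplex R n := cone (@st_psi_d _ S) st_H0.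

(** The composite of phi with psi lifts the map F_(k+1) -> F_k -> syzygy, which
    is 0, so it is null-homotopic.  The homotopy is the second component of the
    next psi, whose first component is phi itself. *)
Lemma next_homotopy : exists s : forall j, ghom (IC k.+1 j) (prev S j),
  forall j x, s j.+1 (ic_d (IC k.+1) j x) =
    st_psi S j (phi k j x) - prev_d (ic_d S) j (s j x).
Proof.
have gex j : exists g : ghom (IF k.+1 j) (S j), g =1 (fun x => st_psi S j (phi k j x)).
  by apply: ghom_of => [a x y|c x]; rewrite ?linearP ?ghom_hcomp.
pose g j := sval (cid (gex j)).
have gE j x : g j x = st_psi S j (phi k j x) by apply: (svalP (cid (gex j))).
pose f j : ghom (augmented (IF k.+1) j) (prev S j) :=
  match j with 0 => gzero_hom (F k.+1) (gzero R n) | j'.+1 => g j' end.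
have fd j x : f j.+1 (augmented_d (IF k.+1) j x) = prev_d (ic_d S) j (f j x).
  case: j x => [|j] x /=; last by rewrite !gE irl_d -st_psi_d.
  by rewrite gE irl_eps; apply/st_ker_psi; exists x.
have [s sE] := null_homotopy (@prev_injective _ _ S) (@prev_dd _ _ S)
  (@augmented_exact _ (IF k.+1)) fd.
by exists (fun j => s j.+1) => j x; rewrite [LHS](sE j.+1 x) /= gE.
Qed.

Definition next_htpy : forall j, ghom (IC k.+1 j) (prev S j) := sval (cid next_homotopy).

Lemma next_htpyE j x : next_htpy j.+1 (ic_d (IC k.+1) j x) =
  st_psi S j (phi k j x) - prev_d (ic_d S) j (next_htpy j x).
Proof. exact: (svalP (cid next_homotopy)). Qed.

Definition next_fun j (x : IC k.+1 j) : next_cx j := (phi k j x, next_htpy j x).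

Lemma next_linear j : linear (@next_fun j).
Proof. by move=> a x y; congr pair; rewrite /= linearP. Qed.

Lemma next_hcomp j c x : @next_fun j (hcomp c x) = hcomp c (@next_fun j x).
Proof. by congr pair; rewrite /= ghom_hcomp. Qed.

Definition next_psi j : ghom (IC k.+1 j) (next_cx j) :=
  mk_ghom (@next_linear j) (@next_hcomp j).

Lemma next_psi_d j x : next_psi j.+1 (ic_d (IC k.+1) j x) = ic_d next_cx j (next_psi j x).
Proof. by congr pair; rewrite /= ?irl_d //; exact: next_htpyE. Qed.

Lemma next_ker_d y : ic_d next_cx 0 y = 0 ->
  exists m, next_psi 0 (ir_eps (IF k.+1) m) = y.
Proof.
case: y => y w [dy]; rewrite [X in X = _ -> _]subr0 => py.
have [m mE] := (ir_exact0 _).1 dy; rewrite -mE in py.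
have [z zE] := (st_ker_psi _ _).1 py; exists z; congr pair; last exact: gzero_eq.
by rewrite /= irl_eps zE.
Qed.

Lemma next_ker_psi m :
  next_psi 0 (ir_eps (IF k.+1) m) = 0 <-> exists y, fr_d F k.+1 y = m.
Proof.
rewrite -fr_exact; split=> [[]|dm].
  by rewrite irl_eps -[X in _ = X](linear0 (ir_eps (IF k))) => /ir_eps_inj.
by congr pair; [rewrite /= irl_eps dm linear0 | exact: gzero_eq].
Qed.

Definition next_stage : stage k.+1 := Stage next_psi_d next_ker_d next_ker_psi.

End Next.

Fixpoint tower (k : nat) : stage k :=
  match k with 0 => stage0 | k'.+1 => next_stage (tower k') end.

End Tower.

(** * Dimension shifting *)

Section DimensionShift.
Variables (R : comNzRingType) (n : nat).
Local Notation P := {mpoly R[n]}.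
Local Notation gmod := (gmod R n).
Variables (M : gmod) (F : gfreeres M) (IM : ginjres M) (IF : forall k, ginjres (F k)).
Variable phi : forall k, ginjres_lift (IF k.+1) (IF k) (fr_d F k).

Local Notation IC k := (resolution_complex (IF k)).
Local Notation J k := (st_cx (tower IM phi k)).
Local Notation psi k := (st_psi (tower IM phi k)).
Local Notation psid k := (@st_psi_d _ _ _ _ _ _ (tower IM phi k)).
Local Notation psiH k := (@st_H0 _ _ _ _ _ _ (tower IM phi k)).
Local Notation HJ k j := (tors_cohomology (ic_d (J k)) j).
Local Notation HF k j := (tors_cohomology (ic_d (IC k)) j).

Definition incl k j (x : J k j) : J k.+1 j.+1 :=
  cone_in (psid k) (psiH k) x.

Lemma inclL k j (a : P) (x y : J k j) : incl (a *: x + y) = a *: incl x + incl y.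
Proof. by congr pair; rewrite /= scaler0 addr0. Qed.

Lemma incl_hcomp k j c (x : J k j) : incl (hcomp c x) = hcomp c (incl x).
Proof. by congr pair; rewrite /= hcomp0. Qed.

Section Degree.
Variable N : nat.
Hypothesis F_acyclic : forall k (j : nat), j != N -> tors_acyclic (ic_d (IC k)) j.
Hypothesis J_acyclic : forall k j, (N < j)%N -> tors_acyclic (ic_d (J k)) j.

(** The cohomology of F_k vanishes in degrees j and j + 1, the two neighbours
    of this map in the long exact sequence of the cone. *)
Lemma shift_gisom k j : (j.+1 < N)%N -> gisom (HJ k j) (HJ k.+1 j.+1).
Proof.
move=> jN.
apply: (@gisom_rel _ _ _ _ (fun h h' => exists2 x, cclass h x & cclass h' (incl x))).
- move=> a h h' g g' [x hx hx'] [y gy gy']; exists (a *: x + y); first exact: cclassL.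
  by rewrite inclL; apply: cclassL.
- move=> c h h' [x hx hx']; exists (hcomp c x); first exact: cclass_hcomp.
  by rewrite incl_hcomp; apply: cclass_hcomp.
- move=> h; have [x hx] := cclass_rep h.
  have [h' hx'] := cclass_of (cone_in_cocycle (psid k)
    (psiH k) (cclass_cocycle hx)).
  by exists h', x.
- move=> h'; have [z hz] := cclass_rep h'.
  have zc := cclass_cocycle hz.
  have [|x xc zx] := cone_in_onto zc.
    apply: F_acyclic; first by rewrite neq_ltn jN.
    by split; [exact: (torsion_fst zc.1) | exact: (congr1 fst zc.2)].
  have [h hx] := cclass_of xc; exists h, x => //.
  have [g gx] := cclass_of (cone_in_cocycle (psid k)
    (psiH k) xc).
  by rewrite ((cclass_eq hz gx).2 zx).
- move=> h' [x hx hx']; apply/(cclass_eq0 hx')/cone_in_bound.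
  by apply/(cclass_eq0 hx).
- move=> h [x hx hx']; apply/(cclass_eq0 hx).
  apply: cone_in_bound_inv ((cclass_eq0 hx').1 erefl).
  by apply: F_acyclic; rewrite neq_ltn ltnW.
Qed.

Lemma shift_gisom_iter p k j : (p + j < N)%N -> gisom (HJ k j) (HJ (p + k) (p + j)).
Proof.
elim: p => [|p IHp] pj; first exact: gisom_refl.
exact: gisom_trans (IHp (ltnW pj)) (shift_gisom _ pj).
Qed.

(** A syzygy of positive index lies in a free module, which has no torsion
    when the top degree is positive. *)
Lemma syzygy_H0 k : (0 < N)%N -> forall h : HJ k.+1 0, h = 0.
Proof.
move=> N0 h; have [[y w] hx] := cclass_rep h; have [tx dx] := cclass_cocycle hx.
have [v _ yE] : tors_bound (ic_d (IC k)) y.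
  apply: F_acyclic; first by rewrite neq_ltn N0.
  by split; [exact: (torsion_fst tx) | exact: (congr1 fst dx)].
apply/(cclass_eq0 hx); exists 0; first exact: torsion0.
by congr pair; [exact: yE | exact: gzero_eq].
Qed.

(** The obstruction lies in the cohomology of the next syzygy above the top
    degree. *)
Lemma psi_ontoN k (x : J k N) : tors_cocycle (ic_d (J k)) x ->
  exists2 y : IC k N, tors_cocycle (ic_d (IC k)) y & tors_bound (ic_d (J k)) (psi k N y - x).
Proof. exact: (@psi_onto _ _ _ _ _ (psid k) (psiH k) _ _ (@J_acyclic k.+1 _ (ltnSn N))). Qed.

(** Top cohomology is right exact: the kernel of psi comes from the next
    syzygy, onto whose top cohomology that of F_(k+1) maps. *)
Lemma psi_kerN k (y : IC k N) :
  tors_cocycle (ic_d (IC k)) y -> tors_bound (ic_d (J k)) (psi k N y) ->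
  exists2 z : IC k.+1 N, tors_cocycle (ic_d (IC k.+1)) z &
    tors_bound (ic_d (IC k)) (phi k N z - y).
Proof.
move=> yc yb.
have [x xc <-] := psi_kernel (psid k) (psiH k) yc yb.
have [z zc zx] := @psi_ontoN k.+1 x xc; exists z => //.
exact: (cone_fst_bound zx).
Qed.

Lemma psi_phi_bound k (z : IC k.+1 N) : tors_cocycle (ic_d (IC k.+1)) z ->
  tors_bound (ic_d (J k)) (psi k N (phi k N z)).
Proof.
move=> [tz dz]; have := next_htpyE phi (tower IM phi k) z; rewrite dz linear0.
move=> /esym/eqP; rewrite subr_eq0 => /eqP pE; rewrite [psi k N _]pE.
by exists (next_htpy phi (tower IM phi k) N z) => //; apply: torsion_map.
Qed.

Local Notation Hphi k := (local_cohomology_map (phi k) N).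

(** Thus the top cohomology of F_k modulo boundaries embeds in that of the k-th
    syzygy.  The map g is left free so that the end of the complex is
    covered. *)
Lemma homology_class_eq0 k (A : gmod) (g : ghom (HF k N) A) (e : homology (Hphi k) g)
    (h : HF k N) (y : IC k N) : hclass e h -> cclass h y ->
  e = 0 <-> tors_bound (ic_d (J k)) (psi k N y).
Proof.
move=> eh hy; rewrite (hclass_eq0 eh); split=> [[h' h'E]|yb].
  have [z hz] := cclass_rep (h' : HF k.+1 N).
  have := cclass_map (phi k) hz; rewrite [local_cohomology_map _ _ _]h'E => hz'.
  have := tors_bound_map (psid k) ((cclass_eq hz' hy).1 erefl); rewrite linearB => pb.
  rewrite -[psi k N y](subKr (psi k N (phi k N z))); apply: tors_boundB => //.
  exact/psi_phi_bound/(cclass_cocycle hz).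
have [z zc zy] := psi_kerN (cclass_cocycle hy) yb.
have [h' hz] := cclass_of zc; exists h'.
exact/(cclass_eq (cclass_map (phi k) hz) hy).
Qed.

Local Notation HHF i := (chain_homology (C := fun k => local_cohomology (IF k) N)
  (fun k => Hphi k) i).

Lemma gisom_homology0 : gisom (HJ 0 N) (HHF 0).
Proof.
apply: (@gisom_rel _ _ _ (HHF 0) (fun h e => exists x y h', [/\ cclass h x,
  cclass (h' : HF 0 N) y, hclass e h' & tors_bound (ic_d (J 0)) (psi 0 N y - x)])).
- move=> a h e g f [x [y [h' [hx hy eh xy]]]] [x1 [y1 [g' [gx gy fg xy1]]]].
  exists (a *: x + x1), (a *: y + y1), (a *: h' + g'); split; try exact: cclassL.
    exact: hclassL.
  have -> : psi 0 N (a *: y + y1) - (a *: x + x1) =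
      a *: (psi 0 N y - x) + (psi 0 N y1 - x1).
    by rewrite linearP scalerBr opprD addrACA.
  exact: tors_boundL.
- move=> c h e [x [y [h' [hx hy eh xy]]]].
  exists (hcomp c x), (hcomp c y), (hcomp c h'); split; try exact: cclass_hcomp.
    exact: hclass_hcomp.
  by rewrite ghom_hcomp -hcompN -hcompD; apply: tors_bound_hcomp.
- move=> h; have [x hx] := cclass_rep h.
  have [y yc yx] := psi_ontoN (cclass_cocycle hx).
  have [h' hy] := cclass_of yc.
  have [|e eh] := @hclass_of _ _ _ _ _ (Hphi 0) (gzero_hom (HF 0 N) (gzero R n)) h'.
    by [].
  by exists e, x, y, h'.
- move=> e; have [h' eh] := hclass_rep e; have [y hy] := cclass_rep (h' : HF 0 N).
  have [ty dy] := cclass_cocycle hy.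
  have [|h hx] := @cclass_of _ _ _ (ic_d (J 0)) N (psi 0 N y).
    by split; [exact: torsion_map | rewrite -st_psi_d dy linear0].
  exists h, (psi 0 N y), y, h'; split=> //; rewrite subrr; exact: tors_bound0.
- move=> e [x [y [h' [hx hy eh xy]]]]; apply/(homology_class_eq0 eh hy).
  by rewrite -(subrK x (psi 0 N y)); apply: tors_boundD => //; apply/(cclass_eq0 hx).
- move=> h [x [y [h' [hx hy eh xy]]]]; apply/(cclass_eq0 hx).
  rewrite -(subKr (psi 0 N y) x); apply: tors_boundB => //.
  exact/(homology_class_eq0 eh hy).
Qed.

Lemma chain_homology_eq0 k : N = 0%N -> forall e : HHF k.+1, e = 0.
Proof.
move=> N0 e; have [h eh] := hclass_rep e; have [y hy] := cclass_rep (h : HF k.+1 N).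
apply/(homology_class_eq0 eh hy).
have [w _ pE] : tors_bound (ic_d (IC k)) (phi k N y).
  by apply/(cclass_eq0 (cclass_map (phi k) hy)); apply: (hclass_cycle eh).
suff -> : psi k.+1 N y = 0 by apply: tors_bound0.
by move: w y pE {hy}; rewrite N0 => w y /= pE; congr pair; [rewrite -pE | exact: gzero_eq].
Qed.

End Degree.

(** In degree m, just below the top, the shift of the k-th syzygy is the kernel
    of the map from the top cohomology of the next syzygy to that of F_k.  As
    the top cohomology of F_(k+1) maps onto that of the next syzygy, this kernel
    is also the group of cycles modulo boundaries in homological degree
    k + 1. *)
Lemma gisom_homologyS m k :
  (forall k (j : nat), j != m.+1 -> tors_acyclic (ic_d (IC k)) j) ->
  (forall k j, (m.+1 < j)%N -> tors_acyclic (ic_d (J k)) j) ->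
  gisom (HJ k m) (chain_homology (C := fun k => local_cohomology (IF k) m.+1)
    (fun k => local_cohomology_map (phi k) m.+1) k.+1).
Proof.
move=> F_acyclic J_acyclic; set HHF := chain_homology _ _.
have Fm : tors_acyclic (ic_d (IC k)) m by apply: F_acyclic; rewrite neq_ltn ltnSn.
apply: (@gisom_rel _ _ _ HHF (fun h e => exists x y h', [/\ cclass h x,
  cclass (h' : HF k.+1 m.+1) y, hclass e h' &
  tors_bound (ic_d (J k.+1)) (psi k.+1 m.+1 y - incl x)])).
- move=> a h e g f [x [y [h' [hx hy eh xy]]]] [x1 [y1 [g' [gx gy fg xy1]]]].
  exists (a *: x + x1), (a *: y + y1), (a *: h' + g'); split; try exact: cclassL.
    exact: hclassL.
  have -> : psi k.+1 m.+1 (a *: y + y1) - incl (a *: x + x1) =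
      a *: (psi k.+1 m.+1 y - incl x) + (psi k.+1 m.+1 y1 - incl x1).
    by rewrite inclL linearP scalerBr opprD addrACA.
  exact: tors_boundL.
- move=> c h e [x [y [h' [hx hy eh xy]]]].
  exists (hcomp c x), (hcomp c y), (hcomp c h'); split; try exact: cclass_hcomp.
    exact: hclass_hcomp.
  by rewrite ghom_hcomp incl_hcomp -hcompN -hcompD; apply: tors_bound_hcomp.
- move=> h; have [x hx] := cclass_rep h.
  have ixc := cone_in_cocycle (psid k) (psiH k) (cclass_cocycle hx).
  have [y yc yx] := @psi_ontoN m.+1 J_acyclic k.+1 (incl x) ixc.
  have [h' hy] := cclass_of yc.
  have [|e eh] := @hclass_of _ _ _ _ _ (local_cohomology_map (phi k.+1) m.+1)
    (local_cohomology_map (phi k) m.+1) h'.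
    apply/(cclass_eq0 (cclass_map (phi k) hy)).
    by have := cone_fst_bound yx; rewrite /= subr0.
  by exists e, x, y, h'.
- move=> e; have [h' eh] := hclass_rep e; have [y hy] := cclass_rep (h' : HF k.+1 m.+1).
  have [ty dy] := cclass_cocycle hy.
  have yc : tors_cocycle (ic_d (J k.+1)) (psi k.+1 m.+1 y).
    by split; [exact: torsion_map | rewrite -st_psi_d dy linear0].
  have [|x xc yx] := @cone_in_onto _ _ _ _ _ (psid k) (psiH k) _ _ yc.
    by apply/(cclass_eq0 (cclass_map (phi k) hy)); apply: (hclass_cycle eh).
  by have [h hx] := cclass_of xc; exists h, x, y, h'.
- move=> e [x [y [h' [hx hy eh xy]]]]; apply/(homology_class_eq0 J_acyclic eh hy).
  rewrite -(subrK (incl x) (psi k.+1 m.+1 y)); apply: tors_boundD => //.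
  by apply: cone_in_bound; apply/(cclass_eq0 hx).
- move=> h [x [y [h' [hx hy eh xy]]]]; apply/(cclass_eq0 hx).
  have b : tors_bound (ic_d (J k.+1)) (incl x).
    rewrite -(subKr (psi k.+1 m.+1 y) (incl x)); apply: tors_boundB => //.
    exact/(homology_class_eq0 J_acyclic eh hy).
  exact: cone_in_bound_inv b.
Qed.

Lemma dimension_shift N :
  (forall k (j : nat), j != N -> tors_acyclic (ic_d (IC k)) j) ->
  (forall k j, (N < j)%N -> tors_acyclic (ic_d (J k)) j) ->
  forall i : int, gisom (extend0 (fun j => HJ 0 j) (N%:Z - i))
    (extend0 (chain_homology (C := fun k => local_cohomology (IF k) N)
      (fun k => local_cohomology_map (phi k) N)) i).
Proof.
move=> F_acyclic J_acyclic [[|k]|k]; first by rewrite subr0; apply: gisom_homology0.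
  have [kN|Nk] := leqP k.+1 N.
    rewrite subzn //; case: N F_acyclic J_acyclic kN => // m F_acyclic J_acyclic km.
    apply: gisom_trans (gisom_homologyS k F_acyclic J_acyclic).
    have := @shift_gisom_iter m.+1 F_acyclic k 0 (m - k).
    by rewrite addn0 subnKC //; apply; apply: ltnSn.
  have -> : N%:Z - k.+1%:Z = Negz (k - N).
    by rewrite NegzE -subSn // -subzn ?opprB // ltnW.
  apply: gisom_zero => [z|]; first exact: gzero_eq.
  case: N F_acyclic J_acyclic Nk => [|m] F_acyclic J_acyclic; rewrite ltnS => mk.
    exact: (chain_homology_eq0 J_acyclic).
  apply: gisom_eq0 (gisom_sym (gisom_homologyS k F_acyclic J_acyclic)) _.
  have := @shift_gisom_iter m.+1 F_acyclic m (k - m) 0.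
  rewrite addn0 subnKC ?(ltnW mk) // => /(_ (ltnSn m))/gisom_sym/gisom_eq0; apply.
  by rewrite -(subnSK mk); exact: (syzygy_H0 F_acyclic).
rewrite (_ : N%:Z - Negz k = (N + k.+1)%:Z); last by rewrite NegzE opprK.
apply: gisom_zero => [h|z]; last exact: gzero_eq.
have [x hx] := cclass_rep (h : HJ 0 (N + k.+1)).
apply/(cclass_eq0 hx)/J_acyclic; last exact: cclass_cocycle hx.
by rewrite addnS ltnS leq_addr.
Qed.

End DimensionShift.

Theorem theorem1p1 (P0 : comNzRingType) (n : nat) (P0noeth : noetherian P0)
    (M : gmod P0 n) (Mfg : gfingen M) (F : gfreeres M)
    (IM : ginjres M) (IF : forall k : nat, ginjres (F k))
    (phi : forall k : nat, ginjres_lift (IF k.+1) (IF k) (fr_d F k))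
    (i : int) :
  gisom
    (extend0 (local_cohomology IM) (n%:Z - i))
    (extend0
       (chain_homology (C := fun k : nat => local_cohomology (IF k) n)
          (fun k : nat => local_cohomology_map (phi k) n)) i).
Proof.
apply: (dimension_shift (IM := IM)) => k j; last exact: tors_acyclic_high.
rewrite neq_ltn => /orP[jn|nj]; last exact: tors_acyclic_high.
exact: tors_acyclic_low (fr_free F k) jn.
Qed.
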